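(* Let $\Phi:(0,+\infty)\to\mathbb{R}$ be convex and satisfy the growth condition $G(\Phi)$, and set $\Phi(0)=\lim_{y\downarrow 0}\Phi(y)$. Assume that $\Phi(0)<+\infty$ and $M_\Phi\cap\mathbb{P}\neq\varnothing$. Let $L=\bigcap_{Q\in M_\Phi}L^1(Q)$, let $L'=\mathrm{Lin}\{M_\Phi\}\subseteq L^1(P)$, and let $\tau$ be any locally convex topology on $L$ compatible with the duality $(L,L')$. Let $$C_\Phi:=\bigcap_{Q\in M_\Phi}\overline{K-L^1_+(Q)}^{Q}\subseteq L .$$ Then: (a) $C_\Phi$ is the $\tau$-closure of $C=(K-L^0_+)\cap L^\infty$ in $L$; (b) $C_\Phi$ and the convex cone $co(M_\Phi)$ generated by $M_\Phi$ are polar to one another, i.e. $(C_\Phi)^0=co(M_\Phi)$ and $(co(M_\Phi))^0=C_\Phi$.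
   Context: Setting: $(\Omega,\mathcal{F},(\mathcal{F}_t)_{t\in[0,T]},P)$ is a filtered probability space whose filtration satisfies the usual conditions (right continuity and completeness). $\mathbb{P}$ is the class of probability measures on $\mathcal{F}$ equivalent to $P$. $X=(X_t)_{t\in[0,T]}$ is an $\mathbb{R}^d$-valued càdlàg semimartingale. An $\mathbb{R}^d$-valued predictable process $H$ is called admissible if it is $X$-integrable and there is a constant $c\in\mathbb{R}$ such that for all $t\in[0,T]$, $\int_0^t H_s\cdot dX_s\ge -c$ $P$-a.s. $L^0$ is the space of ($P$-a.s. equivalence classes of) $P$-a.s. finite random variables on $(\Omega,\mathcal{F})$, $L^0_+$ its cone of $P$-a.s. nonnegative elements, $L^\infty$ the $P$-essentially bounded ones. $K=\{\int_0^T H_s\cdot dX_s \mid H \text{ admissible}\}\subseteq L^0$, and $K-L^0_+=\{f\in L^0: \exists g\in K,\ g\ge f\ P\text{-a.s.}\}$. $M_1$ is the set of probability measures $Q\ll P$ such that $K\subseteq L^1(Q)$ and $E_Q[g]\le 0$ for all $g\in K$. $M_\Phi=\{Q\in M_1: \Phi(dQ/dP)\in L^1(P)\}$, where $\Phi$ is extended to $0$ by $\Phi(0)=\lim_{y\downarrow0}\Phi(y)$. Measures $Q\ll P$ are identified with their densities $dQ/dP\in L^1(P)$. For $Q\in M_1$, $L^1_+(Q)$ is the cone of $Q$-a.s. nonnegative elements of $L^1(Q)$, $K-L^1_+(Q)=\{g-h: g\in K, h\in L^1_+(Q)\}\subseteq L^1(Q)$, and $\overline{A}^{Q}$ denotes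 the closure of $A\subseteq L^1(Q)$ in the $L^1(Q)$-norm. $L$ consists of the random variables in $L^0$ that are $Q$-integrable for every $Q\in M_\Phi$; $L'$ is the linear span of $M_\Phi$ in $L^1(P)$; the pairing is $(z,z')\mapsto E[zz']$ for $z\in L$, $z'\in L'$. A locally convex (not necessarily Hausdorff) topology $\tau$ on $L$ is compatible with the duality if the $\tau$-continuous linear functionals on $L$ are exactly the maps $z\mapsto E[zz']$, $z'\in L'$. For a convex cone $G\subseteq L$, $G^0=\{z'\in L': E[zz']\le0\ \forall z\in G\}$; for a convex cone $G'\subseteq L'$, $(G')^0=\{z\in L: E[zz']\le0\ \forall z'\in G'\}$. In particular $(co(M_\Phi))^0=\{f\in L: E_Q[f]\le 0\ \forall Q\in M_\Phi\}$. Convex cones contain $0$: $G$ is a convex cone if $x,y\in G$ implies $\alpha x+\beta y\in G$ for all $\alpha,\beta\ge0$. Growth condition $G(\Phi)$: for every $[\lambda_0,\lambda_1]\subseteq(0,+\infty)$ there exist $\alpha>0,\beta>0$ such that $\Phi^+(\lambda y)\le\alpha\Phi^+(y)+\beta(y+1)$ for all $y>0$ and all $\lambda\in[\lambda_0,\lambda_1]$, where $\Phi^+=\max(\Phi,0)$. *)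

(* Defs.v *)
From HB Require Import structures.
From mathcomp Require Import all_boot all_order all_algebra.
From mathcomp Require Import all_classical all_reals all_analysis.

Set Implicit Arguments.
Unset Strict Implicit.
Unset Printing Implicit Defensive.

Import Order.TTheory GRing.Theory Num.Theory.
Import numFieldNormedType.Exports.

Local Open Scope classical_set_scope.
Local Open Scope ring_scope.

(* A real process is a map R -> Omega -> R, of which only the times in [0, T]
   matter; an R^d-valued process is the family of its d coordinates. *)

Section Processes.
Context (R : realType) (disp : measure_display) (Omega : measurableType disp).
Variables (P : probability Omega R) (T : R) (F : R -> set (set Omega)).

Definition usual_filtration : Prop :=
  [/\ forall t : R, 0 <= t <= T ->
        sigma_algebra setT (F t) /\ F t `<=` measurable,
      forall s t : R, 0 <= s -> s <= t -> t <= T -> F s `<=` F t,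
      forall t : R, 0 <= t < T -> \bigcap_(s in `]t, T]%classic) F s `<=` F t
    & forall N : set Omega, P.-negligible N -> F 0 N].

Definition measurable_wrt (G : set (set Omega)) (f : Omega -> R) : Prop :=
  forall B : set R, measurable B -> G (f @^-1` B).

Definition adapted (Y : R -> Omega -> R) : Prop :=
  forall t : R, 0 <= t <= T -> measurable_wrt (F t) (Y t).

Definition cadlag (Y : R -> Omega -> R) : Prop :=
  forall w,
    (forall t : R, 0 <= t < T -> Y s w @[s --> t^'+] --> Y t w) /\
    (forall t : R, 0 < t <= T -> cvg (Y s w @[s --> t^'-])).

Definition martingale (M : R -> Omega -> R) : Prop :=
  [/\ adapted M,
      forall t : R, 0 <= t <= T -> P.-integrable setT (EFin \o M t)
    & forall (s t : R) (A : set Omega), 0 <= s -> s <= t -> t <= T -> F s A ->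
        (\int[P]_(w in A) (M t w)%:E = \int[P]_(w in A) (M s w)%:E)%E].

Definition stopping_time (tau : Omega -> R) : Prop :=
  (forall w, 0 <= tau w) /\
  (forall t : R, 0 <= t <= T -> F t [set w | tau w <= t]).

(* On a compact time interval a localizing sequence is one that eventually
   exceeds T; the initial value is not required to be integrable. *)
Definition local_martingale (M : R -> Omega -> R) : Prop :=
  [/\ adapted M, cadlag M &
    exists tau : nat -> Omega -> R,
      [/\ forall n, stopping_time (tau n),
          forall n w, tau n w <= tau n.+1 w,
          {ae P, forall w, exists n, T <= tau n w}
        & forall n,
            martingale (fun t w => M (Num.min t (tau n w)) w - M 0 w)]].

Definition finite_variation (A : R -> Omega -> R) : Prop :=
  [/\ adapted A, cadlag A & forall w, bounded_variation 0 T (A ^~ w)].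

Definition semimartingale (d : nat) (X : 'I_d -> R -> Omega -> R) : Prop :=
  forall i, exists M A : R -> Omega -> R,
    [/\ local_martingale M, finite_variation A
      & forall (t : R) (w : Omega), 0 <= t <= T -> X i t w = M t w + A t w].

Definition predictable_rectangles : set (set (Omega * R)) :=
  [set S | (exists2 A, F 0 A & S = A `*` [set 0]) \/
     (exists (s t : R) (A : set Omega), [/\ 0 <= s, s <= t, t <= T & F s A /\
                        S = A `*` `]s, t]%classic])].

Definition predictable (d : nat) (H : 'I_d -> R -> Omega -> R) : Prop :=
  forall i, measurable_fun
    (setT `*` `[0, T]%classic
       : set (g_sigma_algebraType predictable_rectangles))
    (fun p : g_sigma_algebraType predictable_rectangles => H i p.2 p.1).

(* A list of blocks stands for the elementary integrand
   sum of coef * 1_{]start, stop]}. Integrals run over ]0, t], so that the value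
   of an integrand at time 0 is immaterial. *)
Record block (d : nat) := Block {
  start : R;
  stop : R;
  coef : 'I_d -> Omega -> R
}.

Definition elementary (d : nat) (l : seq (block d)) : Prop :=
  forall j, (j < size l)%N ->
    let b := nth (Block 0 0 (fun _ _ => 0)) l j in
    [/\ 0 <= start b, start b <= stop b, stop b <= T &
      forall i, measurable_wrt (F (start b)) (coef b i) /\
        exists c : R, forall w, `|coef b i w| <= c].

Definition elementary_val (d : nat) (l : seq (block d))
    (i : 'I_d) (t : R) (w : Omega) : R :=
  \sum_(b <- l) coef b i w * \1_(`]start b, stop b]%classic : set R) t.

Definition elementary_int (d : nat) (X : 'I_d -> R -> Omega -> R)
    (l : seq (block d)) (t : R) (w : Omega) : R :=
  \sum_(b <- l) \sum_(i < d) coef b i w *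
    (X i (Num.min (stop b) t) w - X i (Num.min (start b) t) w).

(* E[min(1, sup_{t <= T} |Y_t|)], which metrizes uniform convergence in
   probability. *)
Definition ucp_dist (Y : R -> Omega -> R) : \bar R :=
  (\int[P]_w mine 1 (ereal_sup [set `|Y t w|%:E | t in `[0%R, T]%classic]))%E.

(* Emery's distance of Y to 0 in the semimartingale topology: the supremum of
   ucp_dist (int k dY) over the elementary scalar k with |k| <= 1, the initial
   value being measured apart since integrals do not see it. *)
Definition emery_dist (Y : R -> Omega -> R) : \bar R :=
  ((\int[P]_w mine 1 `|Y 0%R w|%:E) +
   ereal_sup [set ucp_dist (elementary_int (fun _ : 'I_1 => Y) k) | k in
     [set k : seq (block 1) | elementary k /\
        forall (t : R) (w : Omega), (0 < t <= T)%R ->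
          (`|elementary_val k ord0 t w| <= 1)%R]])%E.

(* bounded_int X H Y: Y is a version of the integral of the bounded predictable
   process H with respect to the semimartingale X. This is the graph of the
   unique extension of the elementary integral that obeys bounded convergence
   (boundedly pointwise convergence of integrands gives ucp convergence of the
   integrals); by the monotone class theorem it reaches every bounded
   predictable integrand. *)
Inductive bounded_int (d : nat) (X : 'I_d -> R -> Omega -> R) :
    ('I_d -> R -> Omega -> R) -> (R -> Omega -> R) -> Prop :=
| bounded_int_elementary (l : seq (block d)) :
    elementary l -> bounded_int X (elementary_val l) (elementary_int X l)
| bounded_int_limit (Hn : nat -> 'I_d -> R -> Omega -> R)
    (Yn : nat -> R -> Omega -> R) (H : 'I_d -> R -> Omega -> R)
    (Y : R -> Omega -> R) (c : R) :
    (forall n, bounded_int X (Hn n) (Yn n)) ->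
    (forall n i (t : R) (w : Omega), 0 < t <= T -> `|Hn n i t w| <= c) ->
    (forall i (t : R) (w : Omega), 0 < t <= T ->
       Hn n i t w @[n --> \oo] --> H i t w) ->
    adapted Y -> cadlag Y ->
    ucp_dist (fun t w => Yn n t w - Y t w) @[n --> \oo] --> 0%E ->
    bounded_int X H Y.

(* H is X-integrable with (vector) stochastic integral Y: some bounded
   predictable H^n converge pointwise to H and their integrals converge to Y in
   the semimartingale topology. For X-integrable H one may take the truncations
   H 1_{|H| <= n}; conversely, by Memin's closedness theorem, any such limit is
   the stochastic integral of H. *)
Definition stochastic_int (d : nat) (X H : 'I_d -> R -> Omega -> R)
    (Y : R -> Omega -> R) : Prop :=
  [/\ adapted Y, cadlag Y &
    exists (Hn : nat -> 'I_d -> R -> Omega -> R) (Yn : nat -> R -> Omega -> R),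
      [/\ forall n, bounded_int X (Hn n) (Yn n),
          forall i (t : R) (w : Omega), 0 < t <= T ->
            Hn n i t w @[n --> \oo] --> H i t w
        & emery_dist (fun t w => Yn n t w - Y t w) @[n --> \oo] --> 0%E]].

End Processes.

(* L^0(P): its elements are P-a.s. classes of measurable functions and coerce to
   a representative function. *)
Notation "''L0' [ R ] ( P )" := (aeEqMfun (measurableTypeR R) P)
  (format "''L0' [ R ] ( P )") : type_scope.

Section Market.
Context (R : realType) (disp : measure_display) (Omega : measurableType disp).
Variables (P : probability Omega R) (T : R) (F : R -> set (set Omega)).
Variables (d : nat) (X : 'I_d -> R -> Omega -> R) (Phi : R -> R).

Local Notation L0 := 'L0[R](P).

Definition admissible (H : 'I_d -> R -> Omega -> R) (Y : R -> Omega -> R) :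
    Prop :=
  [/\ predictable T F H, stochastic_int P T F X H Y
    & exists c : R, forall t : R, 0 <= t <= T ->
        {ae P, forall w, - c <= Y t w}].

Definition K : set L0 :=
  [set g : L0 | exists H Y, admissible H Y /\ {ae P, forall w, g w = Y T w}].

Definition K_minus_L0plus : set L0 :=
  [set f : L0 | exists2 g, K g & {ae P, forall w, f w <= g w}].

Definition Linfty : set L0 :=
  [set f : L0 | exists c : R, {ae P, forall w, `|f w| <= c}].

Definition C : set L0 := K_minus_L0plus `&` Linfty.

Definition M1 : set (probability Omega R) :=
  [set Q : probability Omega R | Q `<< P /\ forall g : L0, K g ->
    Q.-integrable setT (EFin \o g) /\ ('E_Q[g] <= 0)%E].

Definition density (Q : probability Omega R) : Omega -> R :=
  fun w => fine (Radon_Nikodym (charge_of_finite_measure Q) P w).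

Definition Phi_at0 : \bar R := lim ((Phi y)%:E @[y --> 0^'+]).

(* Phi extended to [0, +oo[; densities are a.s. nonnegative, so the values at
   negative arguments are irrelevant. *)
Definition Phi_ext (y : R) : \bar R :=
  if 0 < y then (Phi y)%:E else Phi_at0.

Definition MPhi : set (probability Omega R) :=
  [set Q : probability Omega R | M1 Q /\
    P.-integrable setT (fun w => Phi_ext (density Q w))].

Definition growth_condition : Prop :=
  forall l0 l1 : R, 0 < l0 -> l0 <= l1 ->
    exists alpha beta : R, [/\ 0 < alpha, 0 < beta &
      forall y l : R, 0 < y -> l0 <= l <= l1 ->
        Num.max (Phi (l * y)) 0 <=
          alpha * Num.max (Phi y) 0 + beta * (y + 1)].

Definition L : set L0 :=
  [set f : L0 | forall Q : probability Omega R, MPhi Q ->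
    Q.-integrable setT (EFin \o f)].

(* The linear span of MPhi and the convex cone generated by it, measures being
   identified with their densities. *)
Definition L' : set L0 :=
  [set z : L0 | exists n (a : 'I_n -> R) (Q : 'I_n -> probability Omega R),
    (forall i, MPhi (Q i)) /\
    {ae P, forall w, z w = \sum_(i < n) a i * density (Q i) w}].

Definition co_MPhi : set L0 :=
  [set z : L0 | exists n (a : 'I_n -> R) (Q : 'I_n -> probability Omega R),
    (forall i, 0 <= a i /\ MPhi (Q i)) /\
    {ae P, forall w, z w = \sum_(i < n) a i * density (Q i) w}].

Definition pairing (z z' : L0) : \bar R := 'E_P[(fun w => z w * z' w)%R]%E.

Definition polar (G : set L0) : set L0 :=
  [set z' : L0 | L' z' /\ forall z, G z -> (pairing z z' <= 0)%E].

Definition copolar (G' : set L0) : set L0 :=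
  [set z : L0 | L z /\ forall z', G' z' -> (pairing z z' <= 0)%E].

Definition L1plus (Q : probability Omega R) : set (Omega -> R) :=
  [set h | Q.-integrable setT (EFin \o h) /\ {ae Q, forall w, 0 <= h w}].

Definition K_minus_L1plus (Q : probability Omega R) : set (Omega -> R) :=
  [set u | exists (g : L0) (h : Omega -> R),
    [/\ K g, L1plus Q h & u = (fun w => g w - h w)]].

Definition L1_closure (Q : probability Omega R) (A : set (Omega -> R)) :
    set (Omega -> R) :=
  [set f | Q.-integrable setT (EFin \o f) /\
    forall e : R, 0 < e ->
      exists2 u, A u & ('N[Q]_1 [(fun w => (f w - u w)%:E)] < e%:E)%E].

Definition CPhi : set L0 :=
  L `&` [set f : L0 | forall Q : probability Omega R, MPhi Q ->
    L1_closure Q (K_minus_L1plus Q) f].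

(* A locally convex (not necessarily Hausdorff) topology on L is given as a
   locally convex space V together with a linear bijection iota of V onto L. *)
Definition linear_bijection_onto_L (V : tvsType R) (iota : V -> L0) : Prop :=
  [/\ injective iota, range iota = L
    & forall (a : R) (u v : V),
        {ae P, forall w, iota (a *: u + v) w = a * iota u w + iota v w}].

Definition compatible (V : tvsType R) (iota : V -> L0) : Prop :=
  forall phi : {linear V -> R^o},
    continuous phi <->
    exists2 z', L' z' & forall v, (phi v)%:E = pairing (iota v) z'.

End Market.

Arguments admissible [R disp Omega] P T F [d] X H Y.
Arguments K [R disp Omega] P T F [d] X _.
Arguments K_minus_L0plus [R disp Omega] P T F [d] X _.
Arguments C [R disp Omega] P T F [d] X _.
Arguments L [R disp Omega] P T F [d] X Phi _.
Arguments L' [R disp Omega] P T F [d] X Phi _.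
Arguments co_MPhi [R disp Omega] P T F [d] X Phi _.
Arguments polar [R disp Omega] P T F [d] X Phi G _.
Arguments copolar [R disp Omega] P T F [d] X Phi G' _.
Arguments CPhi [R disp Omega] P T F [d] X Phi _.
Arguments linear_bijection_onto_L [R disp Omega] P T F [d] X Phi [V] iota.
Arguments compatible [R disp Omega] P T F [d] X Phi [V] iota.
Arguments Linfty [R disp Omega] P _.
Arguments pairing [R disp Omega] P z z'.

(* Main.v *)
Require Import Defs.
From HB Require Import structures.
From mathcomp Require Import all_boot all_order all_algebra.
From mathcomp Require Import all_classical all_reals all_analysis.
From mathcomp Require Import measurable_realfun lra.

(* The whole duality rests on one closure property of M_Phi: a measure of M_1
   whose density is at most a linear combination of densities of M_Phi lies in
   M_Phi. Indeed Phi is bounded near 0, so by convexity Phi(z) <= max(B, Phi(y))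
   for 0 < z <= y, and the growth condition controls Phi(k y).

   If f in L satisfies E_Q[f] <= 0 on M_Phi but is at positive L1(Q)-distance
   from K - L1_+(Q), a linear functional separating f from this cone is
   integration against a measure Q1 <= c Q; Q1 lies in M_1, hence in M_Phi, and
   E_Q1[f] > 0, a contradiction. So C_Phi is the polar of co(M_Phi).

   If z' in L' is nonpositive on C, testing it on minus indicators shows
   z' >= 0, and testing it on the truncations min(g, n) of g in K shows that the
   normalization of z' lies in M_1, hence in M_Phi. So the polar of C is
   co(M_Phi), and the bipolar theorem gives the rest. *)

Set Implicit Arguments.
Unset Strict Implicit.
Unset Printing Implicit Defensive.
Import Order.TTheory GRing.Theory Num.Theory.
Import numFieldNormedType.Exports.
Local Open Scope classical_set_scope.
Local Open Scope ring_scope.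

(** * Hahn-Banach and separation from a convex cone *)

Section HahnBanach.
Context (R : realType) (V : lmodType R).

(** Two separation arguments are needed because the closures live in different spaces: [CPhi] is
    closed in each L1(Q) separately, while tau is a topology on [L] known only through its
    continuous functionals. Both use Hahn-Banach with a sublinear majorant chosen so as to dictate
    the kind of functional obtained: the gauge of a neighbourhood plus the cone forces
    tau-continuity, and the distance to the cone, which is at most E_Q[u^+], forces integration
    against a measure below a multiple of Q.

    Elements of [K] are bounded below but not above, so they enter [C] only after truncation from
    above, and monotone convergence restores them.

    That [K] is a convex cone takes work: its elements come from limits in Emery's distance of
    bounded integrals, which are themselves reached by ucp limits. Sums and multiples of integrals
    therefore pass through estimates on both distances. These distances integrate suprema over
    uncountably many times, whose measurability comes from the right continuity of paths. *)

Definition sublinear (p : V -> R) : Prop :=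
  (forall x y, p (x + y) <= p x + p y) /\
  (forall t x, 0 < t -> p (t *: x) = t * p x).

(** The inequality for [t^-1] at the point [t *: x] is the reverse inequality for [t] at [x].
    Functionals defined as infima satisfy one inequality directly. *)
Lemma sublinearW (p : V -> R) : (forall x y, p (x + y) <= p x + p y) ->
  (forall t x, 0 < t -> p (t *: x) <= t * p x) -> sublinear p.
Proof.
move=> pD pZ; split=> // t x t0; apply/eqP; rewrite eq_le pZ//=.
have ti0 : 0 < t^-1 by rewrite invr_gt0.
have := pZ t^-1 (t *: x) ti0.
by rewrite scalerA mulVf ?gt_eqF// scale1r mulrC ler_pdivlMr// mulrC.
Qed.

Lemma sublinear0 (p : V -> R) : sublinear p -> p 0 = 0.
Proof. by move=> [_ h]; have := h 2 0 (ltr0Sn _ 1); rewrite scaler0; lra. Qed.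

Lemma sublinear_ge_opp (p : V -> R) x : sublinear p -> - p (- x) <= p x.
Proof.
move=> sp; have := sp.1 x (- x); rewrite subrr sublinear0//; lra.
Qed.

(* A sublinear functional below [p] whose value at [- y] is at most [- p y]. A
   minimal sublinear functional is therefore equal to all its descents, which
   makes it odd, hence linear. *)
Definition descent (p : V -> R) (y x : V) : R :=
  inf [set z | exists2 t, 0 <= t & z = p (x + t *: y) - t * p y].

(** The lower bound [- p (- x)] comes from [t * p y = p (t *: y) <= p (x + t *: y) + p (- x)]. *)
Lemma descent_has_inf p y x : sublinear p ->
  has_inf [set z | exists2 t, 0 <= t & z = p (x + t *: y) - t * p y].
Proof.
move=> sp; split; first by exists (p (x + 0 *: y) - 0 * p y), 0.
exists (- p (- x)) => _ [t t0 ->].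
have := sp.1 (x + t *: y) (- x); rewrite addrAC subrr add0r.
have [t_eq0|t_ne0] := eqVneq t 0.
  by rewrite t_eq0 scale0r sublinear0// addr0; lra.
by rewrite sp.2 ?lt0r ?t_ne0//; lra.
Qed.

Lemma descent_ub p y x t : sublinear p -> 0 <= t ->
  descent p y x <= p (x + t *: y) - t * p y.
Proof.
move=> sp t0; apply: ge_inf; last by exists t.
by have [_] := descent_has_inf y x sp.
Qed.

Lemma descent_approx p y x e : sublinear p -> 0 < e ->
  exists2 t, 0 <= t & p (x + t *: y) - t * p y < descent p y x + e.
Proof.
move=> sp e0; have [_ [t t0 ->] h] := inf_adherent e0 (descent_has_inf y x sp).
by exists t.
Qed.

Lemma sublinear_descent p y : sublinear p -> sublinear (descent p y).
Proof.
move=> sp; apply: sublinearW => [x x'|t x t0].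
  apply/ler_addgt0Pr => e e0.
  have e20 : 0 < e / 2 by rewrite divr_gt0.
  have [t t0 ht] := descent_approx y x sp e20.
  have [s s0 hs] := descent_approx y x' sp e20.
  have := descent_ub y (x + x') sp (addr_ge0 t0 s0).
  have := sp.1 (x + t *: y) (x' + s *: y).
  by rewrite addrACA -scalerDl; lra.
rewrite -ler_pdivrMl//; apply: lb_le_inf.
  by have [] := descent_has_inf y x sp.
move=> _ [s s0 ->]; rewrite ler_pdivrMl//.
have := descent_ub y (t *: x) sp (mulr_ge0 (ltW t0) s0).
by rewrite -scalerA -scalerDr sp.2// mulrBr mulrA.
Qed.

Lemma descent_le p y x : sublinear p -> descent p y x <= p x.
Proof. by move=> sp; have := descent_ub y x sp (lexx 0);
  rewrite scale0r addr0 mul0r subr0. Qed.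

Lemma descent_opp p y : sublinear p -> descent p y (- y) <= - p y.
Proof.
move=> sp; have := descent_ub y (- y) sp ler01.
by rewrite scale1r addNr sublinear0// mul1r sub0r.
Qed.

(** Bundled so that Zorn's lemma ranges over a type; proof irrelevance makes the order
    antisymmetric. *)
Record sublinear_below (p : V -> R) := SublinearBelow {
  sb_val :> V -> R;
  sb_sub : sublinear sb_val;
  sb_le : forall x, sb_val x <= p x }.

(** A chain is bounded by its pointwise infimum, which is finite because [- p (- x)] lies below all
    members. The infimum is subadditive because, of two members nearly optimal at [x] and at [y],
    the smaller one serves at both points. *)
Lemma minimal_sublinear (p : V -> R) : sublinear p ->
  exists q : V -> R, [/\ sublinear q, forall x, q x <= p x &
    forall r : V -> R, sublinear r -> (forall x, r x <= q x) -> r = q].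
Proof.
move=> sp.
(* The order is reversed, so that the maximal elements of Zorn's lemma are the minimal
   functionals. *)
pose rel (q r : sublinear_below p) := `[< forall x, r x <= q x >].
have [||q r /asboolP qr /asboolP rq| A totA |q qmin] := @Zorn _ rel.
- by move=> q; apply/asboolP.
- by move=> q r s /asboolP qr /asboolP rs; apply/asboolP => x;
    exact: le_trans (rs x) (qr x).
- case: q r qr rq => q sq lq [r sr lr] /= qr rq.
  have qr' : q = r by apply/funext => x; apply/eqP; rewrite eq_le qr rq.
  by subst r; congr SublinearBelow; exact: Prop_irrelevance.
- have [[q0 Aq0]|A0] := pselect (A !=set0); last first.
    exists (SublinearBelow sp (fun x => lexx _)) => s As.
    by exfalso; apply: A0; exists s.
  pose S x := [set z | exists2 q : sublinear_below p, A q & z = q x].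
  pose m x := inf (S x).
  have Si x : has_inf (S x).
    split; first by exists (q0 x), q0.
    exists (- p (- x)) => _ [q Aq ->].
    by apply: le_trans (sublinear_ge_opp _ (sb_sub q)); rewrite lerN2 sb_le.
  have mle q x : A q -> m x <= q x.
    by move=> Aq; apply: ge_inf; [have [] := Si x|exists q].
  have sm : sublinear m.
    apply: sublinearW => [x y|t x t0].
      apply/ler_addgt0Pr => e e0.
      have e20 : 0 < e / 2 by rewrite divr_gt0.
      have [_ [q Aq ->] hq] := inf_adherent e20 (Si x).
      have [_ [r Ar ->] hr] := inf_adherent e20 (Si y).
      rewrite -/(m x) in hq; rewrite -/(m y) in hr.
      have [/asboolP h|/asboolP h] := totA _ _ Aq Ar.
        have := mle _ (x + y) Ar; have := (sb_sub r).1 x y; have := h x; lra.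
      have := mle _ (x + y) Aq; have := (sb_sub q).1 x y; have := h y; lra.
    rewrite -ler_pdivrMl//; apply: lb_le_inf; first by have [] := Si x.
    move=> _ [s As ->]; rewrite ler_pdivrMl//.
    by rewrite -(sb_sub s).2//; exact: mle.
  have mp x : m x <= p x by apply: le_trans (mle _ x Aq0) (sb_le _ _).
  by exists (SublinearBelow sm mp) => s As; apply/asboolP => x /=; exact: mle.
exists q; split; [exact: sb_sub|exact: sb_le|] => r sr rq.
have rp x : r x <= p x by apply: le_trans (rq x) (sb_le _ _).
by have <- : SublinearBelow sr rp = q by apply: qmin; exact/asboolP.
Qed.

(** Once [q] is odd, subadditivity at [- x] and [- y] is superadditivity at [x] and [y]. *)
Lemma minimal_sublinear_linear (q : V -> R) : sublinear q ->
  (forall r : V -> R, sublinear r -> (forall x, r x <= q x) -> r = q) ->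
  linear (q : V -> R^o).
Proof.
move=> sq qmin.
have qN x : q (- x) = - q x.
  apply/eqP; rewrite eq_le; apply/andP; split.
    rewrite -[in leLHS](qmin (descent q x)) ?descent_opp//;
      first exact: sublinear_descent.
    by move=> y; exact: descent_le.
  by rewrite lerNl; have := sublinear_ge_opp x sq; lra.
have qD x y : q (x + y) = q x + q y.
  apply/eqP; rewrite eq_le sq.1/=.
  by have := sq.1 (- x) (- y); rewrite -opprD !qN; lra.
have qZ t x : q (t *: x) = t * q x.
  have [t0|t0|<-] := ltgtP 0 t.
  - by rewrite sq.2.
  - have nt0 : 0 < - t by rewrite oppr_gt0.
    by rewrite -[t in LHS]opprK scaleNr qN sq.2//; lra.
  - by rewrite scale0r sublinear0// mul0r.
by move=> t x y; rewrite qD qZ.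
Qed.

(** The minimal functional is taken below [descent p x0] instead of [p]: its value at [- x0] is then
    at most [- p x0], which forces equality at [x0]. *)
Theorem Hahn_Banach_sublinear (p : V -> R) (x0 : V) : sublinear p ->
  exists f : {linear V -> R^o}, (forall x, f x <= p x) /\ f x0 = p x0.
Proof.
move=> sp.
have [q [sq qle qmin]] := minimal_sublinear (sublinear_descent x0 sp).
have lq := minimal_sublinear_linear sq qmin.
pose L := GRing.isLinear.Build R V R^o _ (q : V -> R^o) lq.
pose f : {linear V -> R^o} := HB.pack (q : V -> R^o) L.
have fp x : f x <= p x by apply: le_trans (qle x) (descent_le _ _ sp).
exists f; split=> //; apply/eqP; rewrite eq_le fp/=.
have : f (- x0) <= - p x0 by apply: le_trans (qle _) (descent_opp _ sp).
by rewrite linearN lerN2.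
Qed.

End HahnBanach.

Definition is_cone (R : realType) (V : lmodType R) (G : set V) : Prop :=
  [/\ G 0, forall x y, G x -> G y -> G (x + y)
    & forall t x, 0 < t -> G x -> G (t *: x)].

Section Separation.
Context (R : realType) (V : tvsType R).

(** A convex neighbourhood is intersected with its reflection; symmetry will bound the absolute
    value of a functional, and not only the functional, on [U]. *)
Lemma symmetric_convex_nbhs0 (W : set V) : nbhs 0 W -> exists U : set V,
  [/\ nbhs 0 U, U `<=` W, forall x, U x -> U (- x) &
    forall t x y, 0 <= t -> t <= 1 -> U x -> U y -> U (t *: x + (1 - t) *: y)].
Proof.
move=> W0; have [B Bconv [Bopen Bbasis]] := @locally_convex R V.
have [b /= [Bb b0] bW] := Bbasis 0 W W0.
have nb : nbhs 0 b by apply: open_nbhs_nbhs; split=> //; exact: Bopen.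
have bc t x y : 0 <= t -> t <= 1 -> b x -> b y -> b (t *: x + (1 - t) *: y).
  move=> t0 t1 bx byy; have := Bconv b (mem_set Bb) x y (Itv01 t0 t1).
  by move=> /(_ (mem_set bx) (mem_set byy)) /set_mem.
exists (b `&` [set x | b (- x)]); split.
- apply: filterI => //; have := nbhs0N nb; rewrite /mkset.
  by apply: filterS => _ /= [x bx <-]; rewrite opprK.
- by move=> x [bx _]; exact: bW.
- by move=> x [bx bNx]; split => //=; rewrite opprK.
- move=> t x y t0 t1 [bx bNx] [bY bNy]; split; first exact: bc.
  by rewrite /= opprD -!scalerN; exact: bc.
Qed.

(** Continuity of scalar multiplication at [(0, x)]: the inverse [e / 2] of the witness lies in the
    ball of radius [e] around 0. *)
Lemma absorbing_nbhs0 (U : set V) (x : V) : nbhs 0 U ->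
  exists2 t : R, 0 < t & U (t^-1 *: x).
Proof.
move=> U0; have := @scale_continuous R V (0, x) U; rewrite /= scale0r.
move=> /(_ U0) [[A B] /= [A0 Bx] AB].
move: A0 => /nbhs_ballP[e e0 eA]; have {}e0 : 0 < e := e0.
exists (2 / e); first by rewrite divr_gt0.
apply: (AB ((2 / e)^-1, x)); split => /=; last exact: nbhs_singleton.
apply: eA; rewrite /ball/= sub0r normrN gtr0_norm ?invr_gt0 ?divr_gt0//.
by rewrite invfM invrK mulrC ltr_pdivrMr//; lra.
Qed.

Lemma continuous_linear_bounded (f : {linear V -> R^o}) (U : set V) :
  nbhs 0 U -> (forall x, U x -> `|f x| <= 1) -> continuous f.
Proof.
move=> U0 fU v; apply/cvgrPdist_le => e e0.
have e1 : e != 0 by rewrite gt_eqF.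
have := nbhsT v (nbhs0Z e1 U0); apply: filterS.
move=> _ [_ [u Uu <-] <-]; rewrite linearD linearZ/= opprD addrA subrr sub0r.
by rewrite normrN normrM (gtr0_norm e0) -[leRHS]mulr1 ler_wpM2l ?fU// ltW.
Qed.

(** The gauge of [U + G] is at most 1 on [U], which gives continuity, and at most 0 on [G], since
    [g = e *: 0 + g] for every [e > 0]. As [G] is a cone, [g] stays unscaled in [S]. *)
Theorem tvs_cone_separation (G : set V) (v : V) : is_cone G -> ~ closure G v ->
  exists f : {linear V -> R^o},
    [/\ continuous f, forall g, G g -> f g <= 0 & 0 < f v].
Proof.
move=> [G0 GD GZ] nGv.
have [U [U0 UG US Uc]] : exists U : set V, [/\ nbhs 0 U,
    forall u, U u -> ~ G (v + u), forall x, U x -> U (- x) &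
    forall t x y, 0 <= t -> t <= 1 -> U x -> U y -> U (t *: x + (1 - t) *: y)].
  have [W [Wv WG]] : exists W, nbhs v W /\ W `&` G = set0.
    apply: contrapT => h; apply: nGv => W Wv; rewrite setIC;
      apply/set0P/negP => /eqP WG.
    by apply: h; exists W.
  have W0 : nbhs 0 [set x | W (v + x)].
    have := nbhsB (- v) Wv; rewrite addNr; apply: filterS.
    by move=> _ [w Ww <-] /=; rewrite addrA subrr add0r.
  have [U [U0 UW US Uc]] := symmetric_convex_nbhs0 W0.
  exists U; split=> // u /UW Wu Gu.
  by have : (W `&` G) (v + u) by []; rewrite WG.
have U00 : U 0 by exact: nbhs_singleton.
have Uscale t x : 0 <= t -> t <= 1 -> U x -> U (t *: x).
  by move=> t0 t1 Ux; have := Uc t x 0 t0 t1 Ux U00; rewrite scaler0 addr0.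
(* [p] is the gauge of [U + G]; [p v >= 1] because [v + U] misses [G]. *)
pose S x := [set t : R | 0 < t /\ exists u g, [/\ U u, G g & x = t *: u + g]].
pose p x := inf (S x).
have Si x : has_inf (S x).
  split; last by exists 0 => t [/ltW].
  have [t t0 Ut] := absorbing_nbhs0 x U0.
  exists t; split=> //; exists (t^-1 *: x), 0.
  by rewrite scalerA mulfV ?gt_eqF// scale1r addr0.
have ple x t : S x t -> p x <= t by move=> Sx; apply: ge_inf => //;
  exact: (Si x).2.
have sp : sublinear p.
  apply: sublinearW => [x y|t x t0].
    apply/ler_addgt0Pr => e e0.
    have e20 : 0 < e / 2 by rewrite divr_gt0.
    have [t [t0 [u [g [Uu Gg xE]]]] ht] := inf_adherent e20 (Si x).
    have [s [s0 [u' [g' [Uu' Gg' yE]]]] hs] := inf_adherent e20 (Si y).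
    rewrite -/(p x) in ht; rewrite -/(p y) in hs.
    have ts0 : 0 < t + s by rewrite addr_gt0.
    suff /ple : S (x + y) (t + s) by lra.
    split=> //; exists (t / (t + s) *: u + (1 - t / (t + s)) *: u'), (g + g').
    split; [apply: Uc => //|exact: GD|].
    - by rewrite divr_ge0// ltW.
    - by rewrite ler_pdivrMr//; lra.
    - rewrite xE yE addrACA; congr (_ + _); rewrite scalerDr !scalerA.
      have tE : (t + s) * (t / (t + s)) = t by rewrite mulrC divfK// gt_eqF.
      by rewrite mulrBr mulr1 tE addrAC subrr add0r.
  rewrite -ler_pdivrMl//; apply: lb_le_inf; first exact: (Si x).1.
  move=> s [s0 [u [g [Uu Gg xE]]]]; rewrite ler_pdivrMl//; apply: ple.
  split; first exact: mulr_gt0.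
  by exists u, (t *: g); rewrite xE scalerDr scalerA; split => //; exact: GZ.
have [f [fp fv]] := Hahn_Banach_sublinear v sp.
have fU x : U x -> f x <= 1.
  move=> Ux; apply: le_trans (fp x) _; apply: ple; split=> //.
  by exists x, 0; rewrite scale1r addr0.
exists f; split.
- apply: (continuous_linear_bounded U0) => x Ux; rewrite ler_norml fU// andbT.
  by rewrite lerNl -linearN fU//; exact: US.
- move=> g Gg; apply: le_trans (fp g) _; apply/ler_addgt0Pr => e e0.
  by rewrite add0r; apply: ple; split=> //; exists 0, g; rewrite scaler0 add0r.
- rewrite fv; apply: (@lt_le_trans _ _ 1) => //; apply: lb_le_inf.
    exact: (Si v).1.
  move=> t [t0 [u [g [Uu Gg vE]]]]; rewrite leNgt; apply/negP => /ltW t1.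
  apply: (UG (- (t *: u))); first by apply: US; apply: Uscale => //; exact: ltW.
  by rewrite vE addrAC subrr add0r.
Qed.

End Separation.

(** * Convex functions on the open half-line *)

Section ConvexHalfLine.
Context (R : realType) (f : R -> R).
Hypothesis f_convex : convex_function (E := R^o) `]0, +oo[%classic f.

(** Convexity cleared of denominators, a form on which [lra] and [nra] operate. *)
Lemma convex_three_points (x y z : R) : 0 < x -> x < y -> y < z ->
  (z - x) * f y <= (z - y) * f x + (y - x) * f z.
Proof.
move=> x0 xy yz; have zx : 0 < z - x by lra.
pose t := (z - y) / (z - x).
have tE : t * (z - x) = z - y by rewrite mulfVK// gt_eqF.
have t0 : 0 <= t by rewrite divr_ge0//; lra.
have t1 : t <= 1 by rewrite ler_pdivrMr//; lra.
have := f_convex (Itv01 t0 t1) (x := x) (y := z).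
have xD : x \in (`]0, +oo[%classic : set R) by rewrite inE/= in_itv/= andbT.
have zD : z \in (`]0, +oo[%classic : set R) by rewrite inE/= in_itv/= andbT;
  lra.
move=> /(_ xD zD); rewrite !convRE/= /unstable.onem.
set w := (X in f X); have -> : w = y.
  by rewrite /w /conv/= /unstable.onem /GRing.scale/=; lra.
rewrite -(ler_pM2l zx).
have e1 : t * (z - x) * f x = (z - y) * f x by rewrite tE.
have e2 : t * (z - x) * f z = (z - y) * f z by rewrite tE.
by lra.
Qed.

Lemma convex_le_max (x y z : R) : 0 < x -> x <= y -> y <= z ->
  f y <= Num.max (f x) (f z).
Proof.
move=> x0; rewrite le_eqVlt => /orP[/eqP-> _|xy]; first by rewrite le_max lexx.
rewrite le_eqVlt => /orP[/eqP->|yz]; first by rewrite le_max lexx orbT.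
have h := convex_three_points x0 xy yz.
rewrite leNgt gt_max; apply/negP => /andP[xfy zfy]; nra.
Qed.

(** For [y < 3] the value at 3 lies below the chord from [y] to 4; for [y >= 3] the value at 2 lies
    below the chord from 1 to [y]. Solved for [f y], both are affine lower bounds in [y], and the
    constants are generous. *)
Lemma convex_lower_bound : exists a b : R, [/\ 0 <= a, 0 <= b &
  forall y, 0 < y -> - (a * y + b) <= f y].
Proof.
pose a := `|f 1| + `|f 2| + `|f 3| + `|f 4|.
exists a, (8 * a).
have hl (u : R) : - `|u| <= u by rewrite lerNl -normrN ler_norm.
have hu (u : R) : u <= `|u| := ler_norm u.
move: (hl (f 1)) (hl (f 2)) (hl (f 3)) (hl (f 4)) (hu (f 1)) (hu (f 2)) (hu (f
  3)) (hu (f 4)).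
move: (normr_ge0 (f 1)) (normr_ge0 (f 2)) (normr_ge0 (f 3)) (normr_ge0 (f 4)).
move=> n1 n2 n3 n4 l1 l2 l3 l4 u1 u2 u3 u4.
split; rewrite /a; [lra|lra|] => y y0.
have [y3|y3] := ltP y 3.
  have y4 : (3 : R) < 4 by lra.
  by have := convex_three_points y0 y3 y4; nra.
have y1 : (1 : R) < 2 by lra.
have y2 : 2 < y by lra.
by have := convex_three_points ltr01 y1 y2; nra.
Qed.

(** By [convex_le_max] the sublevel sets are intervals. *)
Lemma measurable_convex : measurable_fun (`]0, +oo[%classic : set R) f.
Proof.
move=> mD; apply: (measurability _ (RGenOInfty.measurableE R)) => //.
move=> _ [_ [a ->] <-].
have -> : `]0, +oo[%classic `&` f @^-1` `]a, +oo[ =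
    `]0, +oo[%classic `\` [set y | 0 < y /\ f y <= a].
  apply/seteqP; split => y /=; rewrite !in_itv/= !andbT.
    by move=> [y0 ay]; split => // -[_]; rewrite leNgt ay.
  by move=> [y0 h]; split => //; rewrite ltNge; apply/negP => ya; apply: h.
apply: measurableD => //; apply: is_interval_measurable.
move=> x z [x0 xa] [z0 za] y /andP[xy yz]; split; first exact: lt_le_trans xy.
by apply: le_trans (convex_le_max x0 xy yz) _; rewrite ge_max xa za.
Qed.

(** Suppose [f z < f x] for some [x < z]. A strict increase between [u < v < x] would give
    [f v < f x], and then [f x] would exceed both [f v] and [f z], against convexity. So [f] is
    nonincreasing on []0, x[]. *)
Lemma convex_monotone_near0 :
  (exists2 d, 0 < d & {in `]0, d[ &, nonincreasing_fun f}) \/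
  {in `]0, +oo[ &, nondecreasing_fun f}.
Proof.
have [|h] := pselect (exists2 d, 0 < d & {in `]0, d[ &, nonincreasing_fun f}).
  by left.
right=> x z; rewrite !in_itv/= !andbT => x0 z0.
rewrite le_eqVlt => /orP[/eqP->//|xz].
apply: contrapT => /negP; rewrite -ltNge => fzx; apply: h; exists x => //.
move=> u v; rewrite !in_itv/= => /andP[u0 ux] /andP[v0 vx].
rewrite le_eqVlt => /orP[/eqP->//|uv].
rewrite leNgt; apply/negP => fuv.
have h1 := convex_three_points u0 uv vx.
have h2 := convex_three_points v0 vx xz.
have : f v < f x by nra.
by nra.
Qed.

End ConvexHalfLine.

(** * The value of Phi at 0 and its bounds near 0 *)

Section PhiAtZero.
Context (R : realType) (Phi : R -> R).
Hypothesis Phi_convex : convex_function (E := R^o) `]0, +oo[%classic Phi.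
Hypothesis Phi0_finite : (Phi_at0 Phi < +oo)%E.

(** Monotonicity near 0 makes the right limit a supremum or an infimum of values. A supremum is
    above [-oo] because it is at least one of the values, an infimum because of the affine lower
    bound on []0, 1[]. *)
Lemma Phi_at0_fin_num : Phi_at0 Phi \is a fin_num.
Proof.
have [[d d0 nif]|ndf] := convex_monotone_near0 Phi_convex.
- have e : (BRight 0 < BLeft d)%O by rewrite bnd_simp.
  have ni : {in Interval (BRight 0) (BLeft d) &,
      nonincreasing_fun (fun y => (Phi y)%:E)}.
    by move=> x y xd yd xy; rewrite lee_fin; exact: nif.
  have /cvg_lim h := nonincreasing_at_right_cvge _ e ni.
  move: Phi0_finite; rewrite /Phi_at0 h// fin_numE => Poo.
  rewrite (lt_eqF Poo) andbT -ltNye; apply: (@lt_le_trans _ _ (Phi (d / 2))%:E).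
    by rewrite ltNyr.
  apply: ereal_sup_ubound; exists (d / 2) => //=.
  by rewrite in_itv/=; apply/andP; split; lra.
- have e : (BRight 0 < BLeft (1:R))%O by rewrite bnd_simp.
  have nd : {in Interval (BRight 0) (BLeft 1) &,
      nondecreasing_fun (fun y => (Phi y)%:E)}.
    move=> x y; rewrite !in_itv/= => /andP[x0 _] /andP[y0 _] xy.
    by rewrite lee_fin; apply: ndf => //; rewrite in_itv/= andbT.
  have /cvg_lim h := nondecreasing_at_right_cvge _ e nd.
  move: Phi0_finite; rewrite /Phi_at0 h// fin_numE => Poo.
  rewrite (lt_eqF Poo) andbT -ltNye.
  have [a [b [a0 b0 lb]]] := convex_lower_bound Phi_convex.
  apply: (@lt_le_trans _ _ (- (a + b))%:E); first by rewrite ltNyr.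
  apply: le_ereal_inf_tmp => _ [x /= + <-]; rewrite in_itv/= => /andP[x0 x1].
  by rewrite lee_fin; apply: le_trans (lb _ x0); rewrite lerN2; nra.
Qed.

Lemma Phi_bounded_near0 : exists d B : R, 0 < d /\
  forall y, 0 < y -> y < d -> Phi y <= B.
Proof.
have [[d d0 nif]|ndf] := convex_monotone_near0 Phi_convex.
- have e : (BRight 0 < BLeft d)%O by rewrite bnd_simp.
  have ni : {in Interval (BRight 0) (BLeft d) &,
      nonincreasing_fun (fun y => (Phi y)%:E)}.
    by move=> x y xd yd xy; rewrite lee_fin; exact: nif.
  have /cvg_lim h := nonincreasing_at_right_cvge _ e ni.
  exists d, (fine (Phi_at0 Phi)); split=> // y y0 yd.
  rewrite -lee_fin fineK ?Phi_at0_fin_num// /Phi_at0 h//.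
  by apply: ereal_sup_ubound; exists y => //=; rewrite in_itv/= y0.
- exists 1, (Phi 1); split=> // y y0 y1.
  by apply: ndf; rewrite ?in_itv/= ?andbT// ltW.
Qed.

Lemma Phi_le_max : exists B : R, forall z y, 0 < z -> z <= y ->
  Phi z <= Num.max B (Phi y).
Proof.
have [d [B [d0 dB]]] := Phi_bounded_near0.
exists B => z y z0 zy.
have [zd|dz] := ltP z d; first by rewrite le_max dB.
have d20 : 0 < d / 2 by rewrite divr_gt0.
have d2z : d / 2 <= z by lra.
apply: le_trans (convex_le_max Phi_convex d20 d2z zy) _.
by rewrite ge_max !le_max lexx orbT andbT dB//; lra.
Qed.

Definition Phi_ext_fine (y : R) : R := fine (Phi_ext Phi y).

Lemma Phi_ext_fineK (y : R) : (Phi_ext_fine y)%:E = Phi_ext Phi y.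
Proof.
by rewrite fineK// /Phi_ext; case: ifPn => // _; exact: Phi_at0_fin_num.
Qed.

Lemma measurable_Phi_ext : measurable_fun [set: R] (Phi_ext Phi).
Proof.
apply: measurable_fun_if => //.
- exact: measurable_fun_ltr.
- rewrite setTI [X in measurable_fun X _](_ : _ = `]0, +oo[%classic).
    by apply/measurable_EFinP; exact: measurable_convex.
  by apply/seteqP; split => y /=; rewrite in_itv/= andbT.
Qed.

End PhiAtZero.

(** * Real-valued integrals and densities *)

Section RealIntegrals.
Context (R : realType) (disp : measure_display) (T : measurableType disp).
Implicit Types (mu : {measure set T -> \bar R}) (u v : T -> R).

Definition intble mu u := mu.-integrable [set: T] (EFin \o u).

Lemma intble_measurable mu u : intble mu u -> measurable_fun setT u.
Proof. by move=> /measurable_int /measurable_EFinP. Qed.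

Lemma intbleD mu u v : intble mu u -> intble mu v ->
  intble mu (fun w => u w + v w).
Proof. exact: integrableD. Qed.

Lemma intbleZ mu c u : intble mu u -> intble mu (fun w => c * u w).
Proof. exact: integrableZl. Qed.

Lemma intbleB mu u v : intble mu u -> intble mu v ->
  intble mu (fun w => u w - v w).
Proof. exact: integrableB. Qed.

Lemma intble_norm mu u : intble mu u -> intble mu (fun w => `|u w|).
Proof. exact: integrable_norm. Qed.

Lemma intble_cst (mu : {finite_measure set T -> \bar R}) (c : R) :
    intble mu (fun=> c).
Proof. exact: finite_measure_integrable_cst. Qed.

Lemma intble_sum mu (I : Type) (s : seq I) (h : I -> T -> R) :
  (forall i, intble mu (h i)) -> intble mu (fun w => \sum_(i <- s) h i w).
Proof.
move=> hi; rewrite /intble.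
have -> : EFin \o (fun w => \sum_(i <- s) h i w) =
    (fun w => \sum_(i <- s) (h i w)%:E)%E by apply/funext => w;
      rewrite /= sumEFin.
by apply: integrable_sum => // i _; exact: hi.
Qed.

Lemma le_intble_ae mu u v : measurable_fun setT u ->
  intble mu v -> {ae mu, forall w, `|u w| <= v w} -> intble mu u.
Proof.
move=> mu_ iv uv; apply/integrableP; split; first exact/measurable_EFinP.
have [mv vfin] := integrableP _ _ _ iv.
apply: le_lt_trans vfin; apply: ae_ge0_le_integral => //.
- by apply: measurableT_comp => //; exact/measurable_EFinP.
- exact: measurableT_comp.
- apply: filterS uv => w uvw _ /=; rewrite lee_fin.
  exact: le_trans uvw (ler_norm _).
Qed.

Lemma intble_ae_eq mu u v : measurable_fun setT v ->
  {ae mu, forall w, u w = v w} -> intble mu u -> intble mu v.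
Proof.
move=> mv uv iu; apply: (le_intble_ae mv (intble_norm iu)).
by apply: filterS uv => w ->.
Qed.

Lemma intble_max0 mu u : intble mu u ->
  intble mu (fun w => Num.max (u w) 0).
Proof.
move=> iu; apply: (le_intble_ae _ (intble_norm iu)).
  by apply: measurable_maxr => //; exact: intble_measurable iu.
apply: aeW => w; have [h|h] := leP (u w) 0; first by rewrite normr0.
by [].
Qed.

Lemma intble_indic (mu : {finite_measure set T -> \bar R}) (A : set T) :
    measurable A -> intble mu \1_A.
Proof.
move=> mA; apply: (le_intble_ae _ (intble_cst mu 1)) => //.
by apply: aeW => w; rewrite indicE; case: (_ \in _); rewrite ?normr1 ?normr0.
Qed.

Lemma le_Rintegral_ae mu u v : intble mu u -> intble mu v ->
  {ae mu, forall w, u w <= v w} -> \int[mu]_w u w <= \int[mu]_w v w.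
Proof.
move=> iu iv uv; rewrite -subr_ge0 -RintegralB//.
have iw := intbleB iv iu; have im := intble_max0 iw.
rewrite /Rintegral (ae_eq_integral (EFin \o (fun w =>
  Num.max (v w - u w) 0)))//.
- by apply: fine_ge0; apply: integral_ge0 => w _ /=;
    rewrite lee_fin le_max lexx orbT.
- exact: measurable_int iw.
- exact: measurable_int im.
- apply: filterS uv => w uvw _ /=; congr EFin.
  by apply/esym/max_idPl; rewrite subr_ge0.
Qed.

Lemma eq_Rintegral_ae mu u v : intble mu u -> intble mu v ->
  {ae mu, forall w, u w = v w} -> \int[mu]_w u w = \int[mu]_w v w.
Proof.
move=> iu iv uv; apply/eqP; rewrite eq_le !le_Rintegral_ae//.
- by apply: filterS uv => w ->.
- by apply: filterS uv => w ->.
Qed.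

Lemma Rintegral_indic mu (A : set T) : measurable A ->
  \int[mu]_w (\1_A w) = fine (mu A) :> R.
Proof. by move=> mA; rewrite /Rintegral integral_indic// setIT. Qed.

Lemma Rintegral_indicM mu u (A : set T) :
  \int[mu]_w (u w * \1_A w) = \int[mu]_(w in A) u w :> R.
Proof.
by rewrite [RHS]Rintegral_mkcond; apply: eq_Rintegral => w _;
  rewrite patch_indic.
Qed.

Lemma intble_Mindic mu u (A : set T) : measurable A ->
  intble mu u -> intble mu (fun w => u w * \1_A w).
Proof.
move=> mA iu; apply: (le_intble_ae _ (intble_norm iu)).
  by apply: measurable_funM => //; exact: intble_measurable iu.
apply: aeW => w; rewrite normrM indicE.
by case: (_ \in _); rewrite ?normr1 ?normr0 ?mulr1 ?mulr0.
Qed.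

Lemma ae_null_dominates mu (nu : {measure set T -> \bar R}) (p : T -> Prop) :
  nu `<< mu -> {ae mu, forall w, p w} -> {ae nu, forall w, p w}.
Proof.
by move=> /null_content_dominatesP h [A [mA A0 pA]]; exists A; split => //;
  exact: h.
Qed.

(** On [A], the set where [u < 0], the function [u] is negative but has a nonnegative integral;
    hence [|u|] has integral 0 over [A]. *)
Lemma ae_ge0_of_Rintegral mu u : intble mu u ->
  (forall A, measurable A -> 0 <= \int[mu]_w (u w * \1_A w)) ->
  {ae mu, forall w, 0 <= u w}.
Proof.
move=> iu h; have mu_ := intble_measurable iu.
pose A := u @^-1` `]-oo, 0[.
have mA : measurable A by rewrite -[A]setTI; exact: mu_.
have iA := intble_Mindic mA iu.
have eN : (\int[mu]_w (`|u w * \1_A w|%:E) = 0)%E.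
  have uN w : `|u w * \1_A w| = - (u w * \1_A w).
    rewrite indicE; case: (boolP (w \in A)) => [|_]; last first.
      by rewrite mulr0 normr0 oppr0.
    by rewrite inE /A/= in_itv/= => u0; rewrite mulr1 ltr0_norm.
  have h0 : \int[mu]_w (`|u w * \1_A w|) = 0.
    apply/eqP; rewrite eq_le Rintegral_ge0 ?andbT//.
    have -> : \int[mu]_w (`|u w * \1_A w|) = \int[mu]_w (-1 * (u w * \1_A w)).
      by apply: eq_Rintegral => w _; rewrite uN mulN1r.
    by rewrite RintegralZl// mulN1r oppr_le0 h.
  rewrite -[LHS]fineK ?(integrable_fin_num _ (intble_norm iA))//.
  by rewrite -[fine _]/(\int[mu]_w (`|u w * \1_A w|)) h0.
have := (ae_eq_integral_abs mu measurableT (measurable_int _ iA)).1 eN.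
apply: filterS => w /(_ I) /= []; rewrite leNgt => /eqP + ;
  apply: contraTN => u0.
by rewrite indicE mem_set ?mulr1 ?lt_eqF// /A/= in_itv.
Qed.

End RealIntegrals.

(** * Densities of probabilities dominated by P *)

Section Density.
Context (R : realType) (disp : measure_display) (Omega : measurableType disp).
Variables (P : probability Omega R).
Implicit Types (Q : probability Omega R).

Lemma EFin_density Q w : Q `<< P ->
  (density P Q w)%:E = Radon_Nikodym (charge_of_finite_measure Q) P w.
Proof. by move=> QP; rewrite /density fineK// Radon_Nikodym_fin_num. Qed.

Lemma intble_density Q : Q `<< P -> intble P (density P Q).
Proof.
move=> QP; rewrite /intble.
have -> : EFin \o density P Q = Radon_Nikodym (charge_of_finite_measure Q) P.
  by apply/funext => w /=; exact: EFin_density.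
exact: Radon_Nikodym_integrable.
Qed.

Lemma density_integral Q A : Q `<< P -> measurable A ->
  (Q A = \int[P]_(w in A) (density P Q w)%:E)%E.
Proof.
move=> QP mA; rewrite [LHS](Radon_Nikodym_integral (nu :=
  charge_of_finite_measure Q) (mu := P))//.
by apply: eq_integral => w _; rewrite EFin_density.
Qed.

Lemma density_Rintegral Q A : Q `<< P -> measurable A ->
  fine (Q A) = \int[P]_w (density P Q w * \1_A w).
Proof. by move=> QP mA; rewrite Rintegral_indicM density_integral. Qed.

Lemma density_ge0 Q : Q `<< P -> {ae P, forall w, 0 <= density P Q w}.
Proof.
move=> QP; apply: ae_ge0_of_Rintegral; first exact: intble_density.
by move=> A mA; rewrite -density_Rintegral// fine_ge0.
Qed.

Lemma intble_density_sum (n : nat) (a : 'I_n -> R) (Q : 'I_n ->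
    probability Omega R) :
  (forall i, Q i `<< P) -> intble P (fun w =>
    \sum_(i < n) a i * density P (Q i) w).
Proof.
by move=> QP; apply: intble_sum => i; apply: intbleZ; exact: intble_density.
Qed.

Lemma intble_densityM Q u : Q `<< P -> intble Q u ->
  intble P (fun w => u w * density P Q w).
Proof.
move=> QP iu.
have iu' := Radon_Nikodym_SigmaFinite.integrableM QP
  (f := fun w => (`|u w|)%:E) (fun w =>
    normr_ge0 _) measurableT (intble_norm iu).
have mu_ : measurable_fun setT u := intble_measurable iu.
have md : measurable_fun setT (density P Q).
  exact: intble_measurable (intble_density QP).
apply/integrableP; split; first by apply/measurable_EFinP;
  exact: measurable_funM.
have [mf] := integrableP _ _ _ iu'; apply: le_lt_trans.
apply: ae_ge0_le_integral => //.
- by do 2 apply: measurableT_comp => //; exact: measurable_funM.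
- exact: measurableT_comp.
have := ae_eq_Radon_Nikodym_SigmaFinite QP measurableT.
apply: filterS => w /(_ I) e _ /=.
by rewrite e -EFin_density// abseM !abse_EFin normr_id -EFinM lee_fin normrM.
Qed.

Lemma Rintegral_density Q u : Q `<< P -> intble Q u ->
  \int[P]_w (u w * density P Q w) = \int[Q]_w u w.
Proof.
move=> QP iu; rewrite /Rintegral; congr fine.
rewrite -(Radon_Nikodym_change_of_variables QP measurableT iu).
by apply: eq_integral => w _ /=; rewrite EFinM EFin_density.
Qed.

Lemma eq_density Q z : Q `<< P -> intble P z ->
  (forall A, measurable A -> fine (Q A) = \int[P]_w (z w * \1_A w)) ->
  {ae P, forall w, density P Q w = z w}.
Proof.
move=> QP iz h; have id := intble_density QP.
have h0 A : measurable A -> \int[P]_w (density P Q w * \1_A w) =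
  \int[P]_w (z w * \1_A w).
  by move=> mA; rewrite -density_Rintegral// h.
have le1 : {ae P, forall w, 0 <= density P Q w - z w}.
  apply: ae_ge0_of_Rintegral; first exact: intbleB.
  move=> A mA; under eq_Rintegral do rewrite mulrBl.
  by rewrite RintegralB ?h0 ?subrr//; exact: intble_Mindic.
have le2 : {ae P, forall w, 0 <= z w - density P Q w}.
  apply: ae_ge0_of_Rintegral; first exact: intbleB.
  move=> A mA; under eq_Rintegral do rewrite mulrBl.
  by rewrite RintegralB ?h0 ?subrr//; exact: intble_Mindic.
by apply: filterS2 le1 le2 => w; lra.
Qed.

Lemma density_le_of_measure_le Q Q' (c : R) : Q `<< P -> Q' `<< P ->
  (forall A, measurable A -> fine (Q' A) <= c * fine (Q A)) ->
  {ae P, forall w, density P Q' w <= c * density P Q w}.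
Proof.
move=> QP QP' h; have id := intble_density QP; have id' := intble_density QP'.
have le1 : {ae P, forall w, 0 <= c * density P Q w - density P Q' w}.
  apply: ae_ge0_of_Rintegral; first by apply: intbleB => //; exact: intbleZ.
  move=> A mA; under eq_Rintegral do rewrite mulrBl -mulrA.
  rewrite RintegralB// ?RintegralZl//; last 3 first.
  - exact: intble_Mindic.
  - by apply: intbleZ; exact: intble_Mindic.
  - exact: intble_Mindic.
  by rewrite -!density_Rintegral// subr_ge0 h.
by apply: filterS le1 => w; rewrite subr_ge0.
Qed.

(** Normalization changes nothing at mass 1 and returns a bundled probability; [P] is only the
    fallback of [mnormalize] for degenerate masses. *)
Lemma probability_of_measure (nu : {measure set Omega -> \bar R}) :
  nu setT = 1%E -> exists Q, forall A, Q A = nu A.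
Proof.
move=> nu1; exists (mnormalize nu P) => A.
by rewrite /= /mnormalize nu1 onee_eq0/= invr1 mule1.
Qed.

End Density.

Lemma ae_forall_ord (R : realType) (disp : measure_display)
    (T : measurableType disp) (mu : {measure set T -> \bar R}) (n : nat)
    (p : 'I_n -> T -> Prop) :
  (forall i, {ae mu, forall w, p i w}) -> {ae mu, forall w, forall i, p i w}.
Proof.
elim: n p => [|n IH] p h; first by apply: aeW => w [].
have := IH (fun i => p (lift ord0 i)) (fun i => h _).
apply: filterS2 (h ord0) => w h0 hl i.
by case: (unliftP ord0 i) => [j ->|->].
Qed.

(** * Stability of M_Phi under domination of densities *)

Section Domination.
Context (R : realType) (disp : measure_display) (Omega : measurableType disp).
Variables (P : probability Omega R) (T : R) (F : R -> set (set Omega)).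
Variables (d : nat) (X : 'I_d -> R -> Omega -> R) (Phi : R -> R).
Hypothesis Phi_convex : convex_function (E := R^o) `]0, +oo[%classic Phi.
Hypothesis Phi_growth : growth_condition Phi.
Hypothesis Phi0_finite : (Phi_at0 Phi < +oo)%E.

Local Notation M1 := (M1 P T F X).
Local Notation MPhi := (MPhi P T F X Phi).
Local Notation phi := (Phi_ext_fine Phi).

Lemma MPhi_dominates Q : MPhi Q -> Q `<< P.
Proof. by case=> -[]. Qed.

Lemma Phi_ext_fine_pos y : 0 < y -> phi y = Phi y.
Proof. by move=> y0; rewrite /Phi_ext_fine /Phi_ext y0. Qed.

Lemma Phi_ext_fine_npos y : y <= 0 -> phi y = phi 0.
Proof. by move=> y0; rewrite /Phi_ext_fine /Phi_ext ltNge y0 ltxx. Qed.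

Lemma Phi_ext_domination (n : nat) (c : R) : 0 <= c -> exists a b al be : R,
  [/\ 0 <= a, 0 <= b, 0 <= al, 0 <= be & forall (z : R) (y : 'I_n -> R),
    (forall i, 0 <= y i) -> z <= c * \sum_(i < n) y i ->
    `|phi z| <= a * `|z| + b + \sum_(i < n) (al * `|phi (y i)| + be * (y i +
      1))].
Proof.
move=> c0; have [B PhiB] := Phi_le_max Phi_convex Phi0_finite.
have [a [b [a0 b0 lb]]] := convex_lower_bound Phi_convex.
(* If [z] exceeded every [k * y i], summing over [i] would give [k * z <= c * n * z], impossible for
   [z > 0] as soon as [k > c * n]. The added 1 also keeps [k] positive when [c * n] is 0. *)
pose k := c * n%:R + 1.
have k0 : 0 < k by rewrite ltr_wpDl// mulr_ge0.
have [al [be [al0 be0 growth]]] := Phi_growth k0 (lexx k).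
exists a, (b + `|B| + `|phi 0|), al, be; split => //; try exact: ltW.
  by rewrite !addr_ge0.
move=> z y y0 zle.
have S0 i : 0 <= al * `|phi (y i)| + be * (y i + 1).
  by rewrite addr_ge0// mulr_ge0 ?addr_ge0// ltW.
have SS0 : 0 <= \sum_(i < n) (al * `|phi (y i)| + be * (y i + 1)).
  by apply: sumr_ge0.
have B0 := normr_ge0 B; have p0 := normr_ge0 (phi 0).
have az0 : 0 <= a * `|z| by rewrite mulr_ge0.
(* All [z <= 0] share the value at 0, which the summand [|phi 0|] of the constant absorbs. *)
have [z_le0|z_gt0] := leP z 0; first by rewrite Phi_ext_fine_npos//; lra.
(* [z] is below a multiple of a single [y i], so that the growth condition is
   only needed at the factor [k]. *)
have [i zi] : exists i, z <= k * y i.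
  apply: contrapT => h; have {}h i : k * y i < z.
    by rewrite ltNge; apply/negP => ?; apply: h; exists i.
  have hs : k * \sum_(i < n) y i <= n%:R * z.
    rewrite mulr_sumr [leRHS](_ : _ = \sum_(i < n) z);
      first by apply: ler_sum => i _; exact: ltW.
    by rewrite sumr_const card_ord mulr_natl.
  have : c * (k * \sum_(i < n) y i) <= c * (n%:R * z) by rewrite ler_wpM2l.
  have : k * z <= k * (c * \sum_(i < n) y i) by rewrite ler_wpM2l// ltW.
  by rewrite /k; lra.
have yi0 : 0 < y i by rewrite -(pmulr_rgt0 _ k0); exact: lt_le_trans zi.
have up : phi z <= `|B| + (al * `|phi (y i)| + be * (y i + 1)).
  rewrite !Phi_ext_fine_pos//; apply: le_trans (PhiB _ _ z_gt0 zi) _.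
  have g := growth (y i) k yi0; have {g} := g _; rewrite lexx => /(_ isT) g.
  have m1 : Num.max (Phi (y i)) 0 <= `|Phi (y i)|.
    by rewrite ge_max ler_norm normr_ge0.
  have m2 : al * Num.max (Phi (y i)) 0 <=
    al * `|Phi (y i)| by rewrite ler_wpM2l// ltW.
  have m3 : Phi (k * y i) <= Num.max (Phi (k * y i)) 0 by rewrite le_max lexx.
  have m4 := ler_norm B; have := S0 i; rewrite Phi_ext_fine_pos// => m5.
  by rewrite ge_max; apply/andP; split; lra.
have sumi : al * `|phi (y i)| + be * (y i + 1) <=
    \sum_(i < n) (al * `|phi (y i)| + be * (y i + 1)).
  by rewrite (bigD1 i)//= lerDl; apply: sumr_ge0.
have lo := lb z z_gt0; rewrite -(Phi_ext_fine_pos z_gt0) in lo.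
rewrite (gtr0_norm z_gt0) in az0 *.
by rewrite ler_norml; apply/andP; split; lra.
Qed.

Lemma measurable_phi : measurable_fun [set: R] phi.
Proof.
have := measurable_Phi_ext Phi_convex.
by apply: (measurableT_comp (f := fine)) => //; exact: measurable_fine.
Qed.

Lemma MPhi_intble Q : MPhi Q -> intble P (fun w => phi (density P Q w)).
Proof.
move=> [_]; rewrite /intble; congr (P.-integrable _ _).
by apply/funext => w /=; rewrite Phi_ext_fineK.
Qed.

Lemma MPhi_of_dominated (n : nat) (c : R) (Qs : 'I_n -> probability Omega R) Q :
  0 <= c -> M1 Q -> (forall i, MPhi (Qs i)) ->
  {ae P, forall w, density P Q w <= c * \sum_(i < n) density P (Qs i) w} ->
  MPhi Q.
Proof.
move=> c0 MQ MQs zle; split => //; have QP : Q `<< P by case: MQ.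
have QsP i : Qs i `<< P := MPhi_dominates (MQs i).
have [a [b [al [be [a0 b0 al0 be0 dom]]]]] := Phi_ext_domination n c0.
suff : intble P (fun w => phi (density P Q w)).
  rewrite /intble; congr (P.-integrable _ _).
  by apply/funext => w /=; rewrite Phi_ext_fineK.
have id := intble_density QP.
apply: (@le_intble_ae _ _ _ P _ (fun w => a * `|density P Q w| + b +
  \sum_(i < n) (al * `|phi (density P (Qs i) w)| + be * (density P (Qs i) w +
    1)))).
- exact: (measurableT_comp measurable_phi (intble_measurable id)).
- apply: intbleD.
    apply: intbleD; last exact: intble_cst.
    by apply: intbleZ; exact: intble_norm.
  apply: intble_sum => i; apply: intbleD.
    by apply: intbleZ; apply: intble_norm; exact: MPhi_intble.
  apply: intbleZ; apply: intbleD; last exact: intble_cst.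
  exact: intble_density.
- have y0 : {ae P, forall w i, 0 <= density P (Qs i) w}.
    exact: (ae_forall_ord (fun i => density_ge0 (QsP i))).
  by apply: filterS2 zle y0 => w zw yw; exact: dom.
Qed.

End Domination.

(** * The terminal values of admissible integrals form a convex cone *)

Section Processes.
Context (R : realType) (disp : measure_display) (Omega : measurableType disp).
Variables (P : probability Omega R) (T : R) (F : R -> set (set Omega)).

Section MeasurableWrt.
Variable G : set (set Omega).
Hypothesis sG : sigma_algebra setT G.
Implicit Types f g : Omega -> R.

(** A sigma-algebra generates itself, so the closure properties of measurable functions become
    available for the members of the filtration. *)
Lemma measurable_wrtP f :
  measurable_wrt G f <-> measurable_fun (setT : set (g_sigma_algebraType G)) f.
Proof.
have mG (A : set (g_sigma_algebraType G)) : measurable A <-> G A.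
  by rewrite -[in X in _ <-> X](sigma_algebra_id sG).
split=> [h _ B mB|h B mB]; first by rewrite setTI; apply/mG; exact: h.
by rewrite -[_ @^-1` _]setTI; apply/mG; exact: h.
Qed.

Lemma measurable_wrt_cst (c : R) : measurable_wrt G (fun=> c).
Proof. by apply/measurable_wrtP; exact: measurable_cst. Qed.

Lemma measurable_wrtD f g : measurable_wrt G f -> measurable_wrt G g ->
  measurable_wrt G (fun w => f w + g w).
Proof.
by move=> /measurable_wrtP mf /measurable_wrtP mg; apply/measurable_wrtP;
  exact: measurable_funD.
Qed.

Lemma measurable_wrtM f g : measurable_wrt G f -> measurable_wrt G g ->
  measurable_wrt G (fun w => f w * g w).
Proof.
by move=> /measurable_wrtP mf /measurable_wrtP mg; apply/measurable_wrtP;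
  exact: measurable_funM.
Qed.

End MeasurableWrt.

Definition cadlag_adapted (Y : R -> Omega -> R) := adapted T F Y /\ cadlag T Y.

Hypothesis F_usual : usual_filtration P T F.

Lemma filtration_sigma t : 0 <= t <= T -> sigma_algebra setT (F t).
Proof. by case: F_usual => h _ _ _ /h[]. Qed.

Lemma filtration_mono s t A : 0 <= s -> s <= t -> t <= T -> F s A -> F t A.
Proof. by case: F_usual => _ h _ _ s0 st tT; exact: h. Qed.

Lemma adapted_measurable Y t : adapted T F Y -> 0 <= t <= T ->
    measurable_fun setT (Y t).
Proof.
move=> aY tT _ B mB; rewrite setTI.
by case: F_usual => h _ _ _; have [_] := h t tT; apply; exact: aY.
Qed.

Lemma cadlag_adapted_cst : cadlag_adapted (fun _ _ => 0).
Proof.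
split=> [t tT|w]; first exact: measurable_wrt_cst (filtration_sigma tT) 0.
split=> t _; first exact: cvg_cst.
exact: is_cvg_cst.
Qed.

Lemma cadlag_adaptedD Y Z : cadlag_adapted Y -> cadlag_adapted Z ->
  cadlag_adapted (fun t w => Y t w + Z t w).
Proof.
move=> [aY cY] [aZ cZ]; split=> [t tT|w].
  by apply: measurable_wrtD (filtration_sigma tT) _ _ (aY t tT) (aZ t tT).
have [rY lY] := cY w; have [rZ lZ] := cZ w.
split=> t tT; first by apply: cvgD; [exact: rY|exact: rZ].
by apply: is_cvgD; [exact: lY|exact: lZ].
Qed.

Lemma cadlag_adaptedZ a Y : cadlag_adapted Y -> cadlag_adapted (fun t w =>
    a * Y t w).
Proof.
move=> [aY cY]; split=> [t tT|w].
  have sF := filtration_sigma tT.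
  exact: measurable_wrtM (sF) _ _ (measurable_wrt_cst sF a) (aY t tT).
have [rY lY] := cY w.
split=> t tT; first by apply: cvgMr; exact: rY.
by apply: is_cvgMr; exact: lY.
Qed.

Lemma cadlag_adaptedB Y Z : cadlag_adapted Y -> cadlag_adapted Z ->
  cadlag_adapted (fun t w => Y t w - Z t w).
Proof.
move=> cY /(cadlag_adaptedZ (-1)) cZ.
have := cadlag_adaptedD cY cZ.
by congr cadlag_adapted; apply/funext => t; apply/funext => w; rewrite mulN1r.
Qed.

Lemma cadlag_adapted_sum (I : Type) (s : seq I) (Y : I -> R -> Omega -> R) :
  (forall i, cadlag_adapted (Y i)) ->
  cadlag_adapted (fun t w => \sum_(i <- s) Y i t w).
Proof.
move=> cY; elim: s => [|i s IH].
  have := cadlag_adapted_cst; congr cadlag_adapted.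
  by apply/funext => t; apply/funext => w; rewrite big_nil.
have := cadlag_adaptedD (cY i) IH; congr cadlag_adapted.
by apply/funext => t; apply/funext => w; rewrite big_cons.
Qed.

(** The one-sided limits in [cadlag] only see nearby times of [[0, T]], which is also where a
    semimartingale is tied to its decomposition. *)
Lemma cadlag_adapted_eq Y Z : (forall t w, 0 <= t <= T -> Y t w = Z t w) ->
  cadlag_adapted Y -> cadlag_adapted Z.
Proof.
move=> YZ [aY cY]; split=> [t tT|w].
  have -> : Z t = Y t by apply/funext => w; rewrite YZ.
  exact: aY.
have [rY lY] := cY w; split=> t /andP[t0 tT].
  rewrite -YZ ?t0 ?(ltW tT)//; apply: cvg_trans (rY t _); last by rewrite t0.
  apply: near_eq_cvg; near=> s; apply: YZ; apply/andP; split.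
    by apply: (le_trans t0); near: s; exact: nbhs_right_ge.
  by near: s; exact: nbhs_right_ltW.
have /cvg_ex[l hl] := lY t ltac:(by rewrite t0).
apply/cvg_ex; exists l; apply: cvg_trans hl.
apply: near_eq_cvg; near=> s; apply: YZ; apply/andP; split.
  by near: s; exact: nbhs_left_ge.
by apply: le_trans tT; near: s; exact: nbhs_left_le.
Unshelve. all: by end_near. Qed.

Lemma cadlag_adapted_stop a Y : 0 <= a -> cadlag_adapted Y ->
  cadlag_adapted (fun t => Y (Num.min a t)).
Proof.
move=> a0 [aY cY]; split=> [t /andP[t0 tT]|w].
  have m0 : 0 <= Num.min a t by rewrite le_min a0.
  have mt : Num.min a t <= t by rewrite ge_min lexx orbT.
  move=> B mB; apply: (filtration_mono m0 mt tT).
  by apply: aY => //; rewrite m0 (le_trans mt).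
have [rY lY] := cY w; split=> t /andP[t0 tT].
  have [at_|ta] := leP a t.
    apply: cvg_near_cst; near=> s; rewrite (min_idPl _)//.
    by apply: (le_trans at_); near: s; exact: nbhs_right_ge.
  apply: cvg_trans (rY t _); last by rewrite t0.
  apply: near_eq_cvg; near=> s; rewrite (min_idPr _)//.
  by near: s; exact: nbhs_right_ltW.
have [ta|at_] := leP t a.
  have /cvg_ex[l hl] := lY t ltac:(by rewrite t0).
  apply/cvg_ex; exists l; apply: cvg_trans hl.
  apply: near_eq_cvg; near=> s; rewrite (min_idPr _)//.
  by apply: le_trans ta; near: s; exact: nbhs_left_le.
apply/cvg_ex; exists (Y a w); apply: cvg_near_cst; near=> s.
by rewrite (min_idPl _)//; near: s; exact: nbhs_left_ge.
Unshelve. all: by end_near. Qed.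

(** The coefficient is measurable only from time [a] on; at earlier times both stopped values are
    [Y t], and the product is 0. *)
Lemma cadlag_adapted_increment (a b : R) (c : Omega -> R) Y : 0 <= a -> a <=
    b ->
  measurable_wrt (F a) c -> cadlag_adapted Y ->
  cadlag_adapted (fun t w => c w * (Y (Num.min b t) w - Y (Num.min a t) w)).
Proof.
move=> a0 ab mc cY; have b0 := le_trans a0 ab.
have [aD cD] := cadlag_adaptedB (cadlag_adapted_stop b0 cY)
  (cadlag_adapted_stop a0 cY).
split=> [t tT|w]; last first.
  have [rD lD] := cD w.
  split=> t tT; first by apply: cvgMr; exact: rD.
  by apply: is_cvgMr; exact: lD.
have sF := filtration_sigma tT; have := aD t tT.
have [at_ aDt|ta _] := leP a t.
  apply: measurable_wrtM (sF) _ _ _ aDt => B mB.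
  by have /andP[_ tT'] := tT; exact: filtration_mono (mc B mB).
have -> : (fun w => c w * (Y (Num.min b t) w - Y t w)) = fun=> 0.
  apply/funext => w; rewrite (min_idPr _) ?subrr ?mulr0//.
  exact: le_trans (ltW ta) ab.
exact: measurable_wrt_cst sF 0.
Qed.

Lemma cadlag_adapted_elementary_int (d : nat) (X : 'I_d -> R -> Omega -> R) l :
  (forall i, cadlag_adapted (X i)) -> elementary T F l ->
  cadlag_adapted (elementary_int X l).
Proof.
move=> cX el.
(* Membership replaces the positions used in [elementary], which would shift along the induction. *)
have : forall b, List.In b l -> [/\ 0 <= start b, start b <= stop b &
    forall i, measurable_wrt (F (start b)) (coef b i)].
  elim: l el => [|b l IH] el c //= [<-|cl].
    by have [b0 bb _ h] := el 0%N isT; split => // i; have [] := h i.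
  by apply: IH cl => j jl; exact: (el j.+1).
elim: l {el} => [|b l IH] hl.
  have := cadlag_adapted_cst; congr cadlag_adapted.
  by apply/funext => t; apply/funext => w; rewrite /elementary_int big_nil.
have [b0 bb mb] := hl b (or_introl erefl).
have {}IH : cadlag_adapted (elementary_int X l).
  by apply: IH => c cl; apply: hl; right.
have cb : cadlag_adapted (fun t w => \sum_(i < d) coef b i w *
    (X i (Num.min (stop b) t) w - X i (Num.min (start b) t) w)).
  by apply: cadlag_adapted_sum => i; exact: cadlag_adapted_increment.
have := cadlag_adaptedD cb IH; congr cadlag_adapted.
by apply/funext => t; apply/funext => w; rewrite /elementary_int big_cons.
Qed.

Lemma semimartingale_cadlag_adapted (d : nat) (X : 'I_d -> R -> Omega -> R) i :
  semimartingale P T F X -> cadlag_adapted (X i).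
Proof.
move=> /(_ i) [M [A [[aM cM _] [aA cA _] XE]]].
apply: (cadlag_adapted_eq (fun t w h => esym (XE t w h))).
exact: cadlag_adaptedD.
Qed.

End Processes.

(** * Triangle inequalities and scaling for the ucp and Emery distances *)

Section Distances.
Context (R : realType) (disp : measure_display) (Omega : measurableType disp).
Variables (P : probability Omega R) (T : R) (F : R -> set (set Omega)).
Hypothesis F_usual : usual_filtration P T F.
Hypothesis T_ge0 : 0 <= T.
Local Notation cadlag_adapted := (cadlag_adapted T F).

Definition sup_abs (Y : R -> Omega -> R) (w : Omega) : \bar R :=
  ereal_sup [set `|Y t w|%:E | t in `[0%R, T]%classic].

(* By right continuity, the times [rational_times n] suffice to compute the
   supremum of a cadlag process over [0, T], whence its measurability. *)
Definition rational_times (n : nat) : R :=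
  if @unpickle rat n is Some q then
    if 0 <= (ratr q : R) <= T then ratr q else T
  else T.

Lemma rational_times_itv n : 0 <= rational_times n <= T.
Proof.
rewrite /rational_times; case: unpickle => [q|]; last by rewrite T_ge0 lexx.
by case: ifP => //; rewrite T_ge0 lexx.
Qed.

Lemma sup_abs_ge0 Y w : (0 <= sup_abs Y w)%E.
Proof.
apply: le_trans (ereal_sup_ubound _); last first.
  by exists 0 => //=; rewrite in_itv/= lexx.
by rewrite lee_fin.
Qed.

Lemma sup_abs_rational Y w : cadlag T Y ->
  sup_abs Y w = ereal_sup (range (fun n => `|Y (rational_times n) w|%:E)).
Proof.
move=> /(_ w) [rY _]; apply/eqP; rewrite eq_le; apply/andP; split; last first.
  apply: ge_ereal_sup => _ [n _ <-]; apply: ereal_sup_ubound.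
  by exists (rational_times n) => //=; rewrite in_itv/= rational_times_itv.
apply: ge_ereal_sup => _ [t /= + <-]; rewrite in_itv/= => /andP[t0].
set M := ereal_sup _.
have Mle n : (`|Y (rational_times n) w|%:E <= M)%E by apply: ereal_sup_ubound;
  exists n.
rewrite le_eqVlt => /orP[/eqP->|tT].
  (* No time of the interval lies to the right of [T], so [T] itself must be listed; it is the value
     at any rational outside [[0, T]], such as -1. *)
  have := Mle (pickle (-1 : rat)); rewrite /rational_times pickleK.
  by rewrite ifF// raddfN/= rmorph1 oppr_ge0 ler10.
rewrite leNgt; apply/negP => Mlt.
have M0 : (0 <= M)%E by apply: le_trans (Mle 0%N); rewrite lee_fin.
have Mfin : M \is a fin_num by rewrite ge0_fin_numE//;
  exact: lt_trans Mlt (ltry _).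
rewrite -(fineK Mfin) lte_fin in Mlt.
have nY : `|Y s w| @[s --> t^'+] --> `|Y t w|.
  by apply: cvg_norm; apply: rY; rewrite t0.
have near1 : \forall s \near t^'+, fine M < `|Y s w|.
  exact: (cvgr_gt _ nY).
have [e /= e0 he] : exists2 e, 0 < e & forall s, t < s -> s < t + e ->
  fine M < `|Y s w|.
  have [e /= e0 he] := near1; exists e => // s ts se.
  by apply: he => //=; rewrite ltr0_norm ?subr_lt0//; lra.
have lt2 : t < Num.min (t + e) T by rewrite lt_min tT andbT; lra.
have [q] := rat_in_itvoo lt2; rewrite in_itv/= lt_min => /and3P[tq qe qT].
have := Mle (pickle q); rewrite /rational_times pickleK.
rewrite ifT; last by rewrite (ltW qT) (le_trans t0 (ltW tq)).
by rewrite -(fineK Mfin) lee_fin leNgt he.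
Qed.

Lemma measurable_sup_abs Y : cadlag_adapted Y ->
    measurable_fun setT (sup_abs Y).
Proof.
move=> [aY cY].
have -> : sup_abs Y = fun w => esups (fun n =>
  `|Y (rational_times n) w|%:E) 0%N.
  apply/funext => w; rewrite sup_abs_rational// /esups /sdrop.
  congr ereal_sup; apply/seteqP; split => _ [n _ <-]; exists n => //.
apply: (measurable_fun_esups (f := fun n w => `|Y (rational_times n) w|%:E)) =>
  n.
apply/measurable_EFinP; apply: (measurableT_comp (f := @Num.norm R R)) => //.
exact: (adapted_measurable F_usual aY (rational_times_itv n)).
Qed.

Lemma ucp_distE Y : ucp_dist P T Y = (\int[P]_w mine 1 (sup_abs Y w))%E.
Proof. by []. Qed.

Lemma mine1_ge0 (x : \bar R) : (0 <= x)%E -> (0 <= mine 1 x)%E.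
Proof. by move=> x0; rewrite le_min lee01. Qed.

Lemma mine1D (x y : \bar R) : (0 <= x)%E -> (0 <= y)%E ->
  (mine 1 (x + y) <= mine 1 x + mine 1 y)%E.
Proof.
move=> x0 y0; have [x1|x1] := leP 1%E x.
  by rewrite ge_min leeDl ?mine1_ge0.
have [y1|y1] := leP 1%E y.
  by rewrite ge_min leeDr.
by rewrite ge_min lexx orbT.
Qed.

(** Truncation at 1 breaks homogeneity: for [c < 1] and large [x] the left side is 1 and the right
    side [c]. This is why scaling by [a] costs the factor [Num.max 1 |a|] below. *)
Lemma mine1Z (c : R) (x : \bar R) : 1 <= c -> (0 <= x)%E ->
  (mine 1 (c%:E * x) <= c%:E * mine 1 x)%E.
Proof.
move=> c1 x0; have [x1|x1] := leP 1%E x;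
  first by rewrite mule1 ge_min lee_fin c1.
by rewrite ge_min lexx orbT.
Qed.

Lemma le_mine1 (x y : \bar R) : (x <= y)%E -> (mine 1 x <= mine 1 y)%E.
Proof. by move=> xy; rewrite le_min !ge_min lexx xy orbT. Qed.

Lemma sup_absD Y Z w : (sup_abs (fun t w => Y t w + Z t w)%R w <= sup_abs Y w +
    sup_abs Z w)%E.
Proof.
apply: ge_ereal_sup => _ [t tT <-].
apply: (@le_trans _ _ (`|Y t w|%:E + `|Z t w|%:E)%E).
  by rewrite -EFinD lee_fin ler_normD.
by apply: leeD; apply: ereal_sup_ubound; exists t.
Qed.

Lemma sup_absZ a Y w : (sup_abs (fun t w => a * Y t w)%R w <=
    (Num.max 1 `|a|)%:E * sup_abs Y w)%E.
Proof.
apply: ge_ereal_sup => _ [t tT <-].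
apply: (@le_trans _ _ ((Num.max 1 `|a|)%:E * `|Y t w|%:E)%E).
  by rewrite -EFinM lee_fin normrM ler_wpM2r// le_max lexx orbT.
apply: lee_wpmul2l; first by rewrite lee_fin le_max ler01.
by apply: ereal_sup_ubound; exists t.
Qed.

Lemma measurable_mine1_sup_abs Y : cadlag_adapted Y ->
  measurable_fun setT (fun w => mine 1 (sup_abs Y w))%E.
Proof.
by move=> cY; apply: measurable_mine;
  [exact: measurable_cst|exact: measurable_sup_abs].
Qed.

Lemma ucp_dist_ge0 Y : (0 <= ucp_dist P T Y)%E.
Proof. by apply: integral_ge0 => w _; apply: mine1_ge0; exact: sup_abs_ge0. Qed.

Lemma ucp_distD Y Z : cadlag_adapted Y -> cadlag_adapted Z ->
  (ucp_dist P T (fun t w => Y t w + Z t w)%R <= ucp_dist P T Y +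
    ucp_dist P T Z)%E.
Proof.
move=> cY cZ; have cYZ := cadlag_adaptedD F_usual cY cZ.
rewrite !ucp_distE -ge0_integralD//; try exact: measurable_mine1_sup_abs.
- apply: ge0_le_integral => //; try exact: measurable_mine1_sup_abs.
  + by move=> w _; apply: mine1_ge0; exact: sup_abs_ge0.
  + by apply: emeasurable_funD; exact: measurable_mine1_sup_abs.
  + move=> w _; apply: le_trans (mine1D (sup_abs_ge0 _ _) (sup_abs_ge0 _ _)).
    exact/le_mine1/sup_absD.
- by move=> w _; apply: mine1_ge0; exact: sup_abs_ge0.
- by move=> w _; apply: mine1_ge0; exact: sup_abs_ge0.
Qed.

Lemma ucp_distZ a Y : cadlag_adapted Y ->
  (ucp_dist P T (fun t w => a * Y t w)%R <=
    (Num.max 1 `|a|)%:E * ucp_dist P T Y)%E.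
Proof.
move=> cY; have caY := cadlag_adaptedZ F_usual a cY.
have m1 : 1 <= Num.max 1 `|a| by rewrite le_max lexx.
have m0 : (0 <= (Num.max 1 `|a|)%:E)%E by rewrite lee_fin (le_trans ler01).
rewrite !ucp_distE -ge0_integralZl//; try exact: measurable_mine1_sup_abs.
- apply: ge0_le_integral => //; try exact: measurable_mine1_sup_abs.
  + by move=> w _; apply: mine1_ge0; exact: sup_abs_ge0.
  + by apply: measurable_funeM; exact: measurable_mine1_sup_abs.
  + move=> w _; apply: le_trans (mine1Z m1 (sup_abs_ge0 _ _)).
    exact/le_mine1/sup_absZ.
- by move=> w _; apply: mine1_ge0; exact: sup_abs_ge0.
Qed.

Definition unit_elementary : set (seq (block R Omega 1)) :=
  [set k | elementary T F k /\ forall (t : R) (w : Omega), (0 < t <= T)%R ->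
     (`|elementary_val k ord0 t w| <= 1)%R].

Definition el_int (Y : R -> Omega -> R) (k : seq (block R Omega 1)) :=
  elementary_int (fun _ : 'I_1 => Y) k.

Lemma emery_distE Y : emery_dist P T F Y =
  ((\int[P]_w mine 1 `|Y 0%R w|%:E) +
   ereal_sup [set ucp_dist P T (el_int Y k) | k in unit_elementary])%E.
Proof. by []. Qed.

Lemma cadlag_adapted_el_int Y k : cadlag_adapted Y -> unit_elementary k ->
  cadlag_adapted (el_int Y k).
Proof. by move=> cY [ek _]; exact: (cadlag_adapted_elementary_int F_usual). Qed.

Lemma unit_elementary0 : unit_elementary [::].
Proof.
split=> [j //|t w _]; by rewrite /elementary_val big_nil normr0.
Qed.

Lemma ereal_sup_ucp_ge0 Y :
  (0 <= ereal_sup [set ucp_dist P T (el_int Y k) | k in unit_elementary])%E.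
Proof.
apply: le_trans (ereal_sup_ubound _); last by exists [::] => //;
  exact: unit_elementary0.
exact: ucp_dist_ge0.
Qed.

Lemma emery_dist_ge0 Y : (0 <= emery_dist P T F Y)%E.
Proof.
rewrite emery_distE adde_ge0 ?ereal_sup_ucp_ge0//.
by apply: integral_ge0 => w _; apply: mine1_ge0; rewrite lee_fin.
Qed.

Lemma el_intD Y Z k : el_int (fun t w => Y t w + Z t w) k =
  fun t w => el_int Y k t w + el_int Z k t w.
Proof.
apply/funext => t; apply/funext => w;
  rewrite /el_int /elementary_int -big_split/=.
by apply: eq_bigr => b _; rewrite -big_split/=; apply: eq_bigr => i _; lra.
Qed.

Lemma el_intZ a Y k : el_int (fun t w => a * Y t w) k =
  fun t w => a * el_int Y k t w.
Proof.
apply/funext => t; apply/funext => w; rewrite /el_int /elementary_int mulr_sumr.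
by apply: eq_bigr => b _; rewrite mulr_sumr; apply: eq_bigr => i _; lra.
Qed.

Lemma measurable_mine1_init Y : cadlag_adapted Y ->
  measurable_fun setT (fun w => mine 1 `|Y 0%R w|%:E)%E.
Proof.
move=> [aY _]; apply: measurable_mine; first exact: measurable_cst.
apply/measurable_EFinP; apply: measurableT_comp => //.
by apply: (adapted_measurable F_usual aY); rewrite lexx.
Qed.

(** For a fixed test integrand the elementary integral is linear in the integrator, so each term of
    the supremum inherits the triangle inequality of [ucp_dist]. *)
Lemma emery_distD Y Z : cadlag_adapted Y -> cadlag_adapted Z ->
  (emery_dist P T F (fun t w => Y t w + Z t w)%R <=
   emery_dist P T F Y + emery_dist P T F Z)%E.
Proof.
move=> cY cZ; have cYZ := cadlag_adaptedD F_usual cY cZ.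
rewrite !emery_distE addeACA; apply: leeD.
- rewrite -ge0_integralD//; try exact: measurable_mine1_init.
  + apply: ge0_le_integral => //; try exact: measurable_mine1_init.
    * exact: measurable_mine1_init cYZ.
    * by apply: emeasurable_funD; exact: measurable_mine1_init.
    * move=> w _; apply: le_trans (mine1D _ _); rewrite ?lee_fin//.
      by apply: le_mine1; rewrite -EFinD lee_fin ler_normD.
- apply: ge_ereal_sup => _ [k uk <-]; rewrite el_intD.
  apply: le_trans (ucp_distD _ _) _; try exact: cadlag_adapted_el_int.
  by apply: leeD; apply: ereal_sup_ubound; exists k.
Qed.

Lemma emery_distZ a Y : cadlag_adapted Y ->
  (emery_dist P T F (fun t w => a * Y t w)%R <=
   (Num.max 1 `|a|)%:E * emery_dist P T F Y)%E.
Proof.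
move=> cY; have caY := cadlag_adaptedZ F_usual a cY.
have m1 : 1 <= Num.max 1 `|a| by rewrite le_max lexx.
have m0 : (0 <= (Num.max 1 `|a|)%:E)%E by rewrite lee_fin (le_trans ler01).
have i0 : (0 <= \int[P]_w mine 1 `|Y 0%R w|%:E)%E.
  by apply: integral_ge0 => w _; apply: mine1_ge0; rewrite lee_fin.
rewrite !emery_distE ge0_muleDr ?ereal_sup_ucp_ge0//; apply: leeD.
- rewrite -ge0_integralZl//; try exact: measurable_mine1_init.
  + apply: ge0_le_integral => //; try exact: measurable_mine1_init.
    * exact: measurable_mine1_init caY.
    * by apply: measurable_funeM; exact: measurable_mine1_init.
    * move=> w _; apply: le_trans (mine1Z m1 _); rewrite ?lee_fin//.
      apply: le_mine1; rewrite -EFinM lee_fin normrM ler_wpM2r//.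
      by rewrite le_max lexx orbT.
- apply: ge_ereal_sup => _ [k uk <-]; rewrite el_intZ.
  apply: le_trans (ucp_distZ _ _) _; first exact: cadlag_adapted_el_int.
  by apply: lee_wpmul2l => //; apply: ereal_sup_ubound; exists k.
Qed.

Lemma emery_dist0 : emery_dist P T F (fun _ _ => 0) = 0%E.
Proof.
have h : (emery_dist P T F (fun _ _ => 0%R) <= 0)%E; last first.
  by apply/eqP; rewrite eq_le h emery_dist_ge0.
rewrite emery_distE -[leRHS]adde0; apply: leeD.
  rewrite integral0_eq// => w _; rewrite normr0.
  by apply/min_idPr; rewrite lee01.
apply: ge_ereal_sup => _ [k uk <-].
rewrite ucp_distE integral0_eq// => w _.
have -> : sup_abs (el_int (fun _ _ => 0%R) k) w = 0%E; last first.
  by apply/min_idPr; rewrite lee01.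
apply/eqP; rewrite eq_le sup_abs_ge0 andbT; apply: ge_ereal_sup => _ [t _ <-].
rewrite lee_fin /el_int /elementary_int big1 ?normr0// => b _.
by rewrite big1// => i _; rewrite subrr mulr0.
Qed.

End Distances.

(** * Linearity of the stochastic integral and stability of admissibility *)

Section StochasticIntegral.
Context (R : realType) (disp : measure_display) (Omega : measurableType disp).
Variables (P : probability Omega R) (T : R) (F : R -> set (set Omega)).
Variables (d : nat) (X : 'I_d -> R -> Omega -> R).
Hypothesis F_usual : usual_filtration P T F.
Hypothesis T_ge0 : 0 <= T.
Hypothesis X_cadlag_adapted : forall i, cadlag_adapted T F (X i).
Local Notation cadlag_adapted := (cadlag_adapted T F).
Local Notation bounded_int := (bounded_int P T F X).
Local Notation stochastic_int := (stochastic_int P T F X).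
Implicit Types (H G : 'I_d -> R -> Omega -> R) (Y Z : R -> Omega -> R).

Lemma elementary_cons b (l : seq (block R Omega d)) : elementary T F (b :: l) ->
  [/\ 0 <= start b, start b <= stop b, stop b <= T,
    forall i, measurable_wrt (F (start b)) (coef b i) &
    exists c, forall i w, `|coef b i w| <= c] /\ elementary T F l.
Proof.
move=> el; split; last by move=> j jl; exact: (el j.+1).
have [b0 bb bT h] := el 0%N isT; split => // [i|]; first by have [] := h i.
have /choice[c hc] : forall i, exists c, forall w, `|coef b i w| <= c.
  by move=> i; have [_] := h i.
exists (\sum_(i < d) `|c i|) => i w; rewrite (bigD1 i)//=.
apply: (le_trans (hc i w)); apply: (le_trans (ler_norm _)).
by rewrite lerDl; apply: sumr_ge0.
Qed.

Lemma elementary_val_bounded (l : seq (block R Omega d)) : elementary T F l ->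
  exists c, forall i t w, `|elementary_val l i t w| <= c.
Proof.
elim: l => [_|b l IH /elementary_cons[[_ _ _ _ [c hc]] /IH [c' hc']]].
  by exists 0 => i t w; rewrite /elementary_val big_nil normr0.
exists (c + c') => i t w; rewrite /elementary_val big_cons.
apply: (le_trans (ler_normD _ _)); apply: lerD; last exact: hc'.
apply: le_trans (hc i w); rewrite normrM ler_piMr// indicE.
by case: (_ \in _); rewrite ?normr1 ?normr0.
Qed.

Lemma bounded_int_bounded H Y : bounded_int H Y ->
  exists c, forall i t w, 0 < t <= T -> `|H i t w| <= c.
Proof.
elim=> [l /elementary_val_bounded[c hc]|Hn Yn {}H {}Y c _ _ hc cvgH _ _ _].
  by exists c.
exists c => i t w tT.
have nH : `|Hn n i t w| @[n --> \oo] --> `|H i t w| by apply: cvg_norm;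
  exact: cvgH.
apply: (ler_cvg_to nH (@cvg_cst _ c nat \oo _)).
by apply: nearW => n; exact: hc.
Qed.

Lemma bounded_int_cadlag_adapted H Y : bounded_int H Y -> cadlag_adapted Y.
Proof.
case=> [l el|? ? ? ? ? _ _ _ aY cY _]; last by split.
exact: (cadlag_adapted_elementary_int F_usual).
Qed.

Lemma bounded_intZ a H Y : bounded_int H Y ->
  bounded_int (fun i t w => a * H i t w) (fun t w => a * Y t w).
Proof.
elim=> [l el|Hn Yn {}H {}Y c bHn IH hc cvgH aY cY cvgY].
  pose scale (b : block R Omega d) := Block (start b) (stop b) (fun i w =>
    a * coef b i w).
  have -> : (fun i t w => a * elementary_val l i t w) =
    elementary_val (map scale l).
    apply/funext => i; apply/funext => t; apply/funext => w.
    rewrite /elementary_val big_map mulr_sumr; apply: eq_bigr => b _ /=.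
    by rewrite mulrA.
  have -> : (fun t w => a * elementary_int X l t w) =
    elementary_int X (map scale l).
    apply/funext => t; apply/funext => w.
    rewrite /elementary_int big_map mulr_sumr; apply: eq_bigr => b _ /=.
    by rewrite mulr_sumr; apply: eq_bigr => i _; rewrite mulrA.
  apply: bounded_int_elementary; elim: l el => [_ [] //|b l IH].
  move=> /elementary_cons[[b0 bb bT mb [c hc]] /IH el] [_|j jl]; last exact: el.
  split=> // i; have sF : sigma_algebra setT (F (start b)).
    by apply: (filtration_sigma F_usual); rewrite b0 (le_trans bb).
  split; first exact: measurable_wrtM (sF) _ _ (measurable_wrt_cst sF a) (mb i).
  by exists (`|a| * c) => w; rewrite normrM ler_wpM2l.
have [aZ cZ] := cadlag_adaptedZ F_usual a (conj aY cY).
apply: (bounded_int_limit IH (c := `|a| * c)) => //.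
- by move=> n i t w tT; rewrite normrM ler_wpM2l// hc.
- by move=> i t w tT; apply: cvgMr; exact: cvgH.
have cD n : cadlag_adapted (fun t w => Yn n t w - Y t w).
  by apply: (cadlag_adaptedB F_usual) => //;
    exact: bounded_int_cadlag_adapted (bHn n).
apply: (@squeeze_cvge _ _ _ _ (cst 0%E) _
  (fun n => (Num.max 1 `|a|)%:E * ucp_dist P T (fun t w =>
    Yn n t w - Y t w)%R)%E).
- apply: nearW => n; rewrite ucp_dist_ge0//=.
  apply: le_trans (ucp_distZ F_usual T_ge0 a (cD n)).
  by under eq_fun do under eq_fun do rewrite -mulrBr.
- exact: cvg_cst.
- rewrite -[0%E](mule0 (Num.max 1 `|a|)%:E); apply: cvgeZl => //.
Qed.

(** Induction on the first derivation, for all [G], and on the second one when [H] is elementary. In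
    a limit step the other summand stays fixed: it cancels in the distance to the limit, and its own
    bound is added to the uniform bound. *)
Lemma bounded_intD H Y G Z : bounded_int H Y -> bounded_int G Z ->
  bounded_int (fun i t w => H i t w + G i t w) (fun t w => Y t w + Z t w).
Proof.
move=> bH; elim: bH G Z => [l el|Hn Yn {}H {}Y c bHn IH hc cvgH aY cY cvgY] G Z.
  elim=> [l' el'|Gn Zn {}G {}Z c bGn IH hc cvgG aZ cZ cvgZ].
    have -> : (fun i t w => elementary_val l i t w + elementary_val l' i t w) =
        elementary_val (l ++ l').
      apply/funext => i; apply/funext => t; apply/funext => w.
      by rewrite /elementary_val big_cat.
    have -> : (fun t w => elementary_int X l t w + elementary_int X l' t w) =
        elementary_int X (l ++ l').
      apply/funext => t; apply/funext => w.
      by rewrite /elementary_int big_cat.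
    apply: bounded_int_elementary; elim: l el => [_ //|b l IH].
    move=> el; have [_ /IH el2] := elementary_cons el.
    by move=> [_|j jl]; [exact: (el 0%N)|exact: el2].
  have [cl hcl] := elementary_val_bounded el.
  have [aW cW] := cadlag_adaptedD F_usual
    (cadlag_adapted_elementary_int F_usual X_cadlag_adapted el) (conj aZ cZ).
  apply: (bounded_int_limit IH (c := cl + c)) => //.
  - move=> n i t w tT; apply: (le_trans (ler_normD _ _)).
    by apply: lerD; [exact: hcl|exact: hc].
  - by move=> i t w tT; apply: cvgD; [exact: cvg_cst|exact: cvgG].
  - apply: cvg_trans cvgZ; apply: near_eq_cvg; apply: nearW => n.
    congr (ucp_dist _ _ _); apply/funext => t; apply/funext => w.
    by rewrite opprD addrACA subrr add0r.
move=> bG; have [c' hc'] := bounded_int_bounded bG.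
have [aW cW] := cadlag_adaptedD F_usual (conj aY cY)
  (bounded_int_cadlag_adapted bG).
apply: (bounded_int_limit (fun n => IH n _ _ bG) (c := c + c')) => //.
- move=> n i t w tT; apply: (le_trans (ler_normD _ _)).
  by apply: lerD; [exact: hc|exact: hc'].
- by move=> i t w tT; apply: cvgD; [exact: cvgH|exact: cvg_cst].
- apply: cvg_trans cvgY; apply: near_eq_cvg; apply: nearW => n.
  congr (ucp_dist _ _ _); apply/funext => t; apply/funext => w.
  by rewrite opprD addrACA subrr addr0.
Qed.

Lemma bounded_int0 : bounded_int (fun _ _ _ => 0) (fun _ _ => 0).
Proof.
have -> : (fun _ _ _ => 0) = @elementary_val R _ Omega d [::].
  apply/funext => i; apply/funext => t; apply/funext => w.
  by rewrite /elementary_val big_nil.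
have -> : (fun _ _ => 0) = elementary_int X [::].
  apply/funext => t; apply/funext => w.
  by rewrite /elementary_int big_nil.
exact: bounded_int_elementary.
Qed.

Lemma stochastic_int0 : stochastic_int (fun _ _ _ => 0) (fun _ _ => 0).
Proof.
have [a0 c0] := cadlag_adapted_cst F_usual.
split=> //; exists (fun _ _ _ _ => 0), (fun _ _ _ => 0); split.
- by move=> n; exact: bounded_int0.
- by move=> i t w _; exact: cvg_cst.
- under eq_fun do under eq_fun do rewrite subr0.
  by rewrite emery_dist0//; exact: cvg_cst.
Qed.

Lemma stochastic_intZ a H Y : stochastic_int H Y ->
  stochastic_int (fun i t w => a * H i t w) (fun t w => a * Y t w).
Proof.
move=> [aY cY [Hn [Yn [bHn cvgH cvgY]]]].
have [aZ cZ] := cadlag_adaptedZ F_usual a (conj aY cY).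
split=> //; exists (fun n i t w => a * Hn n i t w), (fun n t w => a * Yn n t w).
split=> [n|i t w tT|]; first exact: bounded_intZ.
  by apply: cvgMr; exact: cvgH.
have cD n : cadlag_adapted (fun t w => Yn n t w - Y t w).
  by apply: (cadlag_adaptedB F_usual) => //;
    exact: bounded_int_cadlag_adapted (bHn n).
apply: (@squeeze_cvge _ _ _ _ (cst 0%E) _
  (fun n => (Num.max 1 `|a|)%:E * emery_dist P T F (fun t w =>
    Yn n t w - Y t w)%R)%E).
- apply: nearW => n; rewrite emery_dist_ge0//=.
  apply: le_trans (emery_distZ F_usual T_ge0 a (cD n)).
  by under eq_fun do under eq_fun do rewrite -mulrBr.
- exact: cvg_cst.
- rewrite -[0%E](mule0 (Num.max 1 `|a|)%:E); apply: cvgeZl => //.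
Qed.

Lemma stochastic_intD H Y G Z : stochastic_int H Y -> stochastic_int G Z ->
  stochastic_int (fun i t w => H i t w + G i t w) (fun t w => Y t w + Z t w).
Proof.
move=> [aY cY [Hn [Yn [bHn cvgH cvgY]]]] [aZ cZ [Gn [Zn [bGn cvgG cvgZ]]]].
have [aW cW] := cadlag_adaptedD F_usual (conj aY cY) (conj aZ cZ).
split=> //; exists (fun n i t w => Hn n i t w + Gn n i t w).
exists (fun n t w => Yn n t w + Zn n t w).
split=> [n|i t w tT|]; first exact: bounded_intD.
  by apply: cvgD; [exact: cvgH|exact: cvgG].
have cDY n : cadlag_adapted (fun t w => Yn n t w - Y t w).
  by apply: (cadlag_adaptedB F_usual) => //;
    exact: bounded_int_cadlag_adapted (bHn n).
have cDZ n : cadlag_adapted (fun t w => Zn n t w - Z t w).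
  by apply: (cadlag_adaptedB F_usual) => //;
    exact: bounded_int_cadlag_adapted (bGn n).
apply: (@squeeze_cvge _ _ _ _ (cst 0%E) _
  (fun n => emery_dist P T F (fun t w => Yn n t w - Y t w)%R +
     emery_dist P T F (fun t w => Zn n t w - Z t w)%R)%E).
- apply: nearW => n; rewrite emery_dist_ge0//=.
  apply: le_trans (emery_distD F_usual T_ge0 (cDY n) (cDZ n)).
  by under eq_fun do under eq_fun do rewrite opprD addrACA.
- exact: cvg_cst.
- have := cvgeD (isT : (0 +? 0)%E) cvgY cvgZ; rewrite adde0; exact.
Qed.

Lemma predictableD H G : predictable T F H -> predictable T F G ->
  predictable T F (fun i t w => H i t w + G i t w).
Proof. by move=> pH pG i; apply: measurable_funD; [exact: pH|exact: pG]. Qed.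

Lemma predictableZ a H : predictable T F H ->
  predictable T F (fun i t w => a * H i t w).
Proof. by move=> pH i; apply: measurable_funM;
  [exact: measurable_cst|exact: pH]. Qed.

Lemma admissible0 : admissible P T F X (fun _ _ _ => 0) (fun _ _ => 0).
Proof.
split; first by move=> i; exact: measurable_cst.
  exact: stochastic_int0.
by exists 0 => t _; apply: aeW => w; rewrite oppr0.
Qed.

Lemma admissibleZ a H Y : 0 <= a -> admissible P T F X H Y ->
  admissible P T F X (fun i t w => a * H i t w) (fun t w => a * Y t w).
Proof.
move=> a0 [pH sH [c hc]]; split; first exact: predictableZ.
  exact: stochastic_intZ.
exists (a * c) => t tT; apply: filterS (hc t tT) => w h.
by rewrite -mulrN ler_wpM2l.
Qed.

Lemma admissibleD H Y G Z : admissible P T F X H Y -> admissible P T F X G Z ->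
  admissible P T F X (fun i t w => H i t w + G i t w) (fun t w => Y t w +
    Z t w).
Proof.
move=> [pH sH [c hc]] [pG sG [c' hc']]; split; first exact: predictableD.
  exact: stochastic_intD.
exists (c + c') => t tT; apply: filterS2 (hc t tT) (hc' t tT) => w h h'.
by rewrite opprD lerD.
Qed.

End StochasticIntegral.

(** * Classes of measurable functions *)

Section LZero.
Context (R : realType) (disp : measure_display) (Omega : measurableType disp).
Variables (P : probability Omega R).
Local Notation L0 := 'L0[R](P).

Lemma measurable_L0 (f : L0) : measurable_fun setT (f : Omega -> R).
Proof. exact: measurable_funPT (repr f). Qed.

Lemma L0_of (u : Omega -> R) : measurable_fun setT u ->
  exists f : L0, {ae P, forall w, f w = u w}.
Proof.
move=> mu_.
pose g : {mfun Omega >-> measurableTypeR R} :=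
  @mfun_Sub _ _ Omega (measurableTypeR R) u (mem_set mu_).
exists (\pi_(L0)%qT g).
have : (repr (\pi_(L0)%qT g) == g %[mod L0])%qT by rewrite reprK.
by rewrite eqmodE => /asboolP; apply: filterS => w /(_ I).
Qed.

Lemma L0_eq (f g : L0) : {ae P, forall w, f w = g w} -> f = g.
Proof.
move=> fg; rewrite -[f]reprK -[g]reprK; apply/eqP; rewrite eqmodE.
by apply/asboolP; apply: filterS fg => w fgw _.
Qed.

End LZero.

Lemma Rintegral_sum (R : realType) (disp : measure_display) (T :
    measurableType disp)
    (mu : {measure set T -> \bar R}) (I : Type) (s : seq I) (h : I -> T -> R) :
  (forall i, intble mu (h i)) ->
  \int[mu]_w (\sum_(i <- s) h i w) = \sum_(i <- s) \int[mu]_w h i w.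
Proof.
move=> hi; elim: s => [|i s IH].
  rewrite big_nil -[RHS](mul0r (fine (mu setT))) -Rintegral_cst//.
  by apply: eq_Rintegral => w _; rewrite big_nil.
rewrite big_cons -IH -RintegralD; [|by []|exact: hi|exact: intble_sum].
by apply: eq_Rintegral => w _; rewrite big_cons.
Qed.

(** * The cones K and C, the pairing, and the easy inclusions *)

Section Market.
Context (R : realType) (disp : measure_display) (Omega : measurableType disp).
Variables (P : probability Omega R) (T : R) (F : R -> set (set Omega)).
Variables (d : nat) (X : 'I_d -> R -> Omega -> R) (Phi : R -> R).
Local Notation L0 := 'L0[R](P).
Local Notation K := (K P T F X).
Local Notation C := (C P T F X).
Local Notation L := (L P T F X Phi).
Local Notation MPhi := (MPhi P T F X Phi).
Local Notation M1 := (M1 P T F X).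
Local Notation co_MPhi := (co_MPhi P T F X Phi).
Implicit Types (f g z : L0) (Q : probability Omega R).

Hypothesis F_usual : usual_filtration P T F.
Hypothesis T_ge0 : 0 <= T.
Hypothesis X_semimartingale : semimartingale P T F X.

Let cX i : cadlag_adapted T F (X i) :=
  semimartingale_cadlag_adapted F_usual i X_semimartingale.

Lemma K0 : exists2 g, K g & {ae P, forall w, g w = 0}.
Proof.
have [g g0] := L0_of P (@measurable_cst _ _ Omega (measurableTypeR R) setT 0).
exists g => //; exists (fun _ _ _ => 0), (fun _ _ => 0); split=> //.
exact: admissible0.
Qed.

(** Operations on classes are expressed through representatives: the sum is a class a.s. equal to
    the pointwise sum. *)
Lemma KD g1 g2 : K g1 -> K g2 ->
  exists2 g, K g & {ae P, forall w, g w = g1 w + g2 w}.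
Proof.
move=> [H1 [Y1 [adm1 e1]]] [H2 [Y2 [adm2 e2]]].
have [g ge] := L0_of P (measurable_funD (measurable_L0 g1) (measurable_L0 g2)).
exists g => //; exists (fun i t w => H1 i t w + H2 i t w), (fun t w => Y1 t w +
  Y2 t w).
split; first exact: admissibleD.
by apply: filterS3 ge e1 e2 => w -> /= -> ->.
Qed.

Lemma KZ a g1 : 0 <= a -> K g1 -> exists2 g, K g & {ae P, forall w, g w =
    a * g1 w}.
Proof.
move=> a0 [H1 [Y1 [adm1 e1]]].
have [g ge] := L0_of P (measurable_funM
  (@measurable_cst _ _ Omega (measurableTypeR R) setT a) (measurable_L0 g1)).
exists g => //; exists (fun i t w => a * H1 i t w), (fun t w => a * Y1 t w).
split; first exact: admissibleZ.
by apply: filterS2 ge e1 => w -> /= ->.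
Qed.

Lemma K_bounded_below g : K g -> exists c, {ae P, forall w, - c <= g w}.
Proof.
move=> [H [Y [[_ _ [c hc]] e]]]; exists c.
have := hc T; rewrite T_ge0 lexx => /(_ isT) h.
by apply: filterS2 h e => w ? ->.
Qed.

(** The source of all elements of [C] used below: sums, multiples, minus indicators and
    truncations. *)
Lemma C_intro (u : Omega -> R) c g : measurable_fun setT u -> K g ->
  {ae P, forall w, `|u w| <= c} -> {ae P, forall w, u w <= g w} ->
  exists2 f, C f & {ae P, forall w, f w = u w}.
Proof.
move=> mu_ Kg uc ug; have [f fu] := L0_of P mu_; exists f => //; split.
  by exists g => //; apply: filterS2 fu ug => w ->.
by exists c; apply: filterS2 fu uc => w ->.
Qed.

Lemma C0 : exists2 f, C f & {ae P, forall w, f w = 0}.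
Proof.
have [g Kg g0] := K0; apply: (@C_intro (fun=> 0) 0 g) => //.
- by apply: aeW => w; rewrite normr0.
- by apply: filterS g0 => w ->.
Qed.

Lemma CD f1 f2 : C f1 -> C f2 -> exists2 f, C f & {ae P, forall w, f w = f1 w +
    f2 w}.
Proof.
move=> [[g1 Kg1 h1] [c1 b1]] [[g2 Kg2 h2] [c2 b2]].
have [g Kg ge] := KD Kg1 Kg2.
apply: (@C_intro (fun w => f1 w + f2 w) (c1 + c2) g) => //.
- by apply: measurable_funD; exact: measurable_L0.
- apply: filterS2 b1 b2 => w h h'; apply: (le_trans (ler_normD _ _)).
  exact: lerD.
- by apply: filterS3 ge h1 h2 => w -> *; exact: lerD.
Qed.

Lemma CZ a f1 : 0 <= a -> C f1 -> exists2 f, C f & {ae P, forall w, f w =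
    a * f1 w}.
Proof.
move=> a0 [[g1 Kg1 h1] [c1 b1]].
have [g Kg ge] := KZ a0 Kg1.
apply: (@C_intro (fun w => a * f1 w) (a * c1) g) => //.
- by apply: measurable_funM; [exact: measurable_cst|exact: measurable_L0].
- by apply: filterS b1 => w h; rewrite normrM ger0_norm// ler_wpM2l.
- by apply: filterS2 ge h1 => w -> *; exact: ler_wpM2l.
Qed.

Lemma L_intble f Q : L f -> MPhi Q -> intble Q f.
Proof. by move=> Lf MQ; exact: Lf. Qed.

Lemma K_intble g Q : K g -> M1 Q -> intble Q g.
Proof. by move=> Kg [_ h]; have [] := h g Kg. Qed.

Lemma K_Rintegral g Q : K g -> M1 Q -> \int[Q]_w g w <= 0.
Proof.
move=> Kg [QP h]; have [ig] := h g Kg; rewrite unlock => le0.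
by rewrite -lee_fin /Rintegral fineK//; exact: integrable_fin_num.
Qed.

Lemma intble_bounded Q f c : Q `<< P -> {ae P, forall w, `|f w| <= c} ->
    intble Q f.
Proof.
move=> QP fc; apply: (@le_intble_ae _ _ _ Q _ (fun=> c)).
- exact: measurable_L0.
- exact: intble_cst.
- exact: ae_null_dominates fc.
Qed.

Lemma C_subset_L : C `<=` L.
Proof.
move=> f [_ [c fc]] Q MQ; apply: intble_bounded fc; exact: MPhi_dominates MQ.
Qed.

(** Since [f] is in [L], it is integrable under each [Q i], and a change of measure applies term by
    term. Integrability of the product is recorded as well because it allows passing between
    extended and real expectations. *)
Lemma pairing_sum f z n (a : 'I_n -> R) (Q : 'I_n -> probability Omega R) :
  L f -> (forall i, MPhi (Q i)) ->
  {ae P, forall w, z w = \sum_(i < n) a i * density P (Q i) w} ->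
  intble P (fun w => f w * z w) /\
  pairing P f z = (\sum_(i < n) a i * \int[Q i]_w f w)%:E.
Proof.
move=> Lf MQ ze; have QP i := MPhi_dominates (MQ i).
have if_ i : intble P (fun w => a i * (f w * density P (Q i) w)).
  by apply: intbleZ; apply: intble_densityM => //; exact: L_intble.
have e : {ae P, forall w, \sum_(i < n) a i * (f w * density P (Q i) w) =
  f w * z w}.
  by apply: filterS ze => w ->; rewrite mulr_sumr; apply: eq_bigr => i _;
    rewrite mulrCA.
have is_ := intble_sum (index_enum 'I_n) if_.
have ifz : intble P (fun w => f w * z w).
  apply: intble_ae_eq e is_.
  by apply: measurable_funM; exact: measurable_L0.
split=> //; rewrite /pairing unlock -[LHS]fineK; last exact: integrable_fin_num.
congr EFin; rewrite -[LHS]/(\int[P]_w (f w * z w)) -(eq_Rintegral_ae is_ ifz e).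
rewrite Rintegral_sum//; apply: eq_bigr => i _.
rewrite RintegralZl//; last by apply: intble_densityM => //; exact: L_intble.
by rewrite Rintegral_density//; exact: L_intble.
Qed.

(** The sign condition on a generated cone is the sign condition on its generators. *)
Lemma copolar_co_MPhi f : copolar P T F X Phi co_MPhi f <->
  L f /\ forall Q, MPhi Q -> \int[Q]_w f w <= 0.
Proof.
split=> [[Lf h]|[Lf h]]; split=> //.
  move=> Q MQ; have QP := MPhi_dominates MQ.
  have [z ze] := L0_of P (intble_measurable (intble_density QP)).
  have zs : {ae P, forall w, z w = \sum_(i < 1) 1 * density P Q w}.
    by apply: filterS ze => w ->; rewrite big_ord1 mul1r.
  have : (pairing P f z <= 0)%E.
    apply: h; exists 1%N, (fun=> 1), (fun=> Q); split=> //.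
  have [_ ->] := @pairing_sum f z 1%N (fun=> 1) (fun=> Q) Lf (fun=> MQ) zs.
  by rewrite big_ord1 mul1r lee_fin.
move=> z [n [a [Q [aQ ze]]]].
have [_ ->] := pairing_sum Lf (fun i => (aQ i).2) ze.
rewrite lee_fin; apply: sumr_le0 => i _.
by apply: mulr_ge0_le0; [exact: (aQ i).1|apply: h; exact: (aQ i).2].
Qed.

(** If [f] is within [e] of [g - k] in L1(Q), then [E_Q[f] <= e + E_Q[g] - E_Q[k] <= e]. *)
Lemma CPhi_subset_copolar : CPhi P T F X Phi `<=` copolar P T F X Phi co_MPhi.
Proof.
move=> f [Lf h]; apply/copolar_co_MPhi; split=> // Q MQ.
have iff_ := L_intble Lf MQ; have M1Q : M1 Q by case: MQ.
have [_ hQ] := h Q MQ; apply/ler_addgt0Pr => e e0.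
have [_ [g [k [Kg [ik k0] ->]]] Nlt] := hQ e e0.
have ig := K_intble Kg M1Q.
have igk : intble Q (fun w => g w - k w) by exact: intbleB.
have idiff : intble Q (fun w => f w - (g w - k w)) by exact: intbleB.
have le1 : \int[Q]_w (f w - (g w - k w)) <= e.
  apply: le_trans (_ : \int[Q]_w `|f w - (g w - k w)| <= _).
    apply: le_Rintegral_ae => //; first exact: intble_norm.
    by apply: aeW => w; exact: ler_norm.
  rewrite -lee_fin /Rintegral fineK; last first.
    exact: integrable_fin_num (intble_norm idiff).
  by move: Nlt; rewrite Lnorm1 => /ltW.
rewrite !RintegralB// in le1.
have le2 := K_Rintegral Kg M1Q.
have le3 : 0 <= \int[Q]_w k w.
  have -> : 0 = \int[Q]_w (cst 0 w) :> R by rewrite Rintegral_cst// mul0r.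
  by apply: le_Rintegral_ae => //; exact: intble_cst.
lra.
Qed.

Lemma C_subset_copolar : C `<=` copolar P T F X Phi co_MPhi.
Proof.
move=> f Cf; have Lf := C_subset_L Cf.
apply/copolar_co_MPhi; split=> // Q MQ; have M1Q : M1 Q by case: MQ.
have [[g Kg fg] _] := Cf.
apply: le_trans (K_Rintegral Kg M1Q); apply: le_Rintegral_ae.
- exact: L_intble.
- exact: K_intble.
- by apply: ae_null_dominates fg; exact: MPhi_dominates MQ.
Qed.

End Market.

(** * The polar of [C] *)

Lemma Rintegral_cst_probability (R : realType) (disp : measure_display)
    (T : measurableType disp) (Q : probability T R) (k : R) : \int[Q]_w k = k.
Proof.
rewrite Rintegral_cst// -[RHS]mulr1; congr (_ * _).
exact: (congr1 fine (probability_setT Q)).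
Qed.

(** Monotone convergence is applied to [min(g, n) + k] with [k = |c|], cut at 0 so as to be
    nonnegative everywhere and not just a.s. The integrals are at most [k], which yields both the
    integrability of [g] and the sign of its integral. *)
Lemma intble_of_truncations (R : realType) (disp : measure_display)
    (T : measurableType disp) (Q : probability T R) (g : T -> R) (c : R) :
  measurable_fun setT g -> {ae Q, forall w, - c <= g w} ->
  (forall n : nat, \int[Q]_w (Num.min (g w) n%:R) <= 0) ->
  intble Q g /\ \int[Q]_w g w <= 0.
Proof.
move=> mg gc gn; pose k := `|c|.
have gk : {ae Q, forall w, 0 <= g w + k}.
  apply: filterS gc => w h; rewrite -(opprK k) subr_ge0; apply: le_trans h.
  by rewrite lerN2 ler_norm.
pose h (n : nat) w := Num.max (Num.min (g w) n%:R + k) 0.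
have mmin n : measurable_fun setT (fun w =>
  Num.min (g w) n%:R) by exact: measurable_minr.
have mh n : measurable_fun setT (h n).
  by apply: measurable_maxr => //; exact: measurable_funD.
have hE n : {ae Q, forall w, h n w = Num.min (g w) n%:R + k}.
  apply: filterS gk => w gw; apply/max_idPl.
  have [gn'|gn'] := leP (g w) n%:R => //.
  have n0 : (0 : R) <= n%:R by [].
  have k0 : 0 <= k by rewrite /k.
  by lra.
have imin n : intble Q (fun w => Num.min (g w) n%:R).
  apply: (@le_intble_ae _ _ _ Q _ (fun=> k + n%:R)) => //;
    first exact: intble_cst.
  apply: filterS gk => w gw.
  have n0 : (0 : R) <= n%:R by [].
  have k0 : 0 <= k by rewrite /k.
  by rewrite ler_norml; case: (leP (g w) n%:R) => ?; apply/andP; split; lra.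
have ih n : intble Q (h n).
  apply: intble_ae_eq (mh n) _ (intbleD (imin n) (intble_cst Q k)).
  by apply: filterS (hE n) => w ->.
have inth n : (\int[Q]_w (h n w)%:E <= k%:E)%E.
  rewrite -[leLHS]fineK ?lee_fin; last exact: integrable_fin_num (ih n).
  rewrite -[fine _]/(\int[Q]_w h n w).
  rewrite (eq_Rintegral_ae (ih n) (intbleD (imin n) (intble_cst Q k)) (hE n)).
  rewrite (RintegralD _ (imin n) (intble_cst Q k))//.
  rewrite Rintegral_cst_probability.
  by have := gn n; lra.
pose h_lim w := Num.max (g w + k) 0.
have mhl : measurable_fun setT h_lim.
  by apply: measurable_maxr => //; exact: measurable_funD.
have nd_h w n m : (n <= m)%N -> h n w <= h m w.
  move=> nm; have : (n%:R : R) <= m%:R by rewrite ler_nat.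
  rewrite /h ge_max !le_max lexx orbT andbT => nm'; apply/orP; left.
  by rewrite lerD2r le_min !ge_min lexx nm' orbT.
have cvgh : (\int[Q]_w (h n w)%:E @[n --> \oo] --> \int[Q]_w limn (fun n =>
  (h n w)%:E))%E.
  apply: cvg_monotone_convergence => //.
  - by move=> n; apply/measurable_EFinP.
  - by move=> n w _; rewrite lee_fin /h le_max lexx orbT.
  - by move=> w _ n m nm; rewrite lee_fin; exact: nd_h.
have limh w : limn (fun n => (h n w)%:E) = (h_lim w)%:E.
  apply/cvg_lim => //; apply: cvg_near_cst.
  (* From this index on, [n] exceeds [g w], so the truncation is inactive and the sequence is
     constant. *)
  exists (Num.truncn `|g w|).+1 => // n /= hn; congr EFin;
    congr (Num.max (_ + k) 0).
  apply/min_idPl; apply: le_trans (ler_norm _) _; apply: ltW.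
  by apply: lt_le_trans (truncnS_gt _) _; rewrite ler_nat.
have intl : (\int[Q]_w (h_lim w)%:E <= k%:E)%E.
  under eq_integral do rewrite -limh.
  by apply: cvge_to_le cvgh _; apply: nearW.
have il : intble Q h_lim.
  apply/integrableP; split; first exact/measurable_EFinP.
  apply: le_lt_trans (ltry k); apply: le_trans intl;
    apply: ge0_le_integral => //.
  - by apply: measurableT_comp => //; exact/measurable_EFinP.
  - exact/measurable_EFinP.
  - by move=> w _ /=; rewrite lee_fin ger0_norm// le_max lexx orbT.
have gE : {ae Q, forall w, h_lim w - k = g w}.
  by apply: filterS gk => w gw; rewrite /h_lim (max_idPl _)// addrK.
have ilk : intble Q (fun w => h_lim w - k) by apply: intbleB => //;
  exact: intble_cst.
have ig := intble_ae_eq mg gE ilk.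
split=> //; rewrite -(eq_Rintegral_ae ilk ig gE) RintegralB//;
  last exact: intble_cst.
rewrite Rintegral_cst_probability subr_le0.
by rewrite -lee_fin /Rintegral fineK//; exact: integrable_fin_num il.
Qed.

(** As [z] is nonnegative only a.s., the measure is built from [max(z, 0)], whose charge is
    nonnegative on every set. *)
Lemma probability_of_density (R : realType) (disp : measure_display)
    (T : measurableType disp) (P : probability T R) (z : T -> R) :
  intble P z -> {ae P, forall w, 0 <= z w} -> \int[P]_w z w = 1 ->
  exists2 Q : probability T R, Q `<< P & {ae P, forall w, density P Q w = z w}.
Proof.
move=> iz z0 z1; pose y w := Num.max (z w) 0.
have iy : intble P y by exact: intble_max0.
have yz : {ae P, forall w, z w = y w}.
  by apply: filterS z0 => w h; apply/esym/max_idPl.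
have nu0 A : (0 <= induced_charge iy A)%E.
  by apply: integral_ge0 => w _; rewrite lee_fin le_max lexx orbT.
pose nu := measure_of_charge (induced_charge iy) nu0.
have nuT : nu setT = 1%E.
  rewrite /nu /measure_of_charge /induced_charge.
  rewrite -[LHS]fineK ?(integrable_fin_num _ iy)//; congr EFin.
  by rewrite -z1; apply/esym; exact: eq_Rintegral_ae.
have [Q QE] := probability_of_measure P nuT.
have QP : Q `<< P.
  apply/null_content_dominatesP => A mA PA.
  rewrite QE; apply: null_set_integral => //.
  apply: measurable_funTS; exact: measurable_int iy.
exists Q => //; apply: (eq_density QP iz) => A mA.
have iyA := intble_Mindic mA iy; have izA := intble_Mindic mA iz.
have e : {ae P, forall w, z w * \1_A w = y w * \1_A w}.
  by apply: filterS yz => w ->.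
by rewrite (eq_Rintegral_ae izA iyA e) Rintegral_indicM QE.
Qed.

Section PolarOfC.
Context (R : realType) (disp : measure_display) (Omega : measurableType disp).
Variables (P : probability Omega R) (T : R) (F : R -> set (set Omega)).
Variables (d : nat) (X : 'I_d -> R -> Omega -> R) (Phi : R -> R).
Local Notation L0 := 'L0[R](P).
Local Notation K := (K P T F X).
Local Notation C := (C P T F X).
Local Notation MPhi := (MPhi P T F X Phi).
Local Notation M1 := (M1 P T F X).
Local Notation co_MPhi := (co_MPhi P T F X Phi).

Hypothesis F_usual : usual_filtration P T F.
Hypothesis T_ge0 : 0 <= T.
Hypothesis Phi_convex : convex_function (E := R^o) `]0, +oo[%classic Phi.
Hypothesis Phi_growth : growth_condition Phi.
Hypothesis Phi0_finite : (Phi_at0 Phi < +oo)%E.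

(** Lets an element of the polar be tested on plain functions, each of which is replaced by its
    class in [C]. *)
Lemma polar_C_Rintegral (z : L0) (u : Omega -> R) c g :
  polar P T F X Phi C z -> measurable_fun setT u -> K g ->
  {ae P, forall w, `|u w| <= c} -> {ae P, forall w, u w <= g w} ->
  intble P (fun w => u w * z w) /\ \int[P]_w (u w * z w) <= 0.
Proof.
move=> [[n [a [Q [MQ zE]]]] h] mu_ Kg uc ug.
have [f Cf fu] := C_intro mu_ Kg uc ug.
have [ifz fzE] := pairing_sum (C_subset_L Cf) MQ zE.
have e : {ae P, forall w, f w * z w = u w * z w} by apply: filterS fu => w ->.
have iuz : intble P (fun w => u w * z w).
  apply: intble_ae_eq e ifz; apply: measurable_funM => //; exact: measurable_L0.
split=> //; rewrite -(eq_Rintegral_ae ifz iuz e) -lee_fin.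
have := h f Cf; rewrite /pairing unlock.
by rewrite /Rintegral fineK//; exact: integrable_fin_num ifz.
Qed.

Lemma M1_of_polar_C (z : L0) (m : R) (Q : probability Omega R) :
    polar P T F X Phi C z -> 0 < m ->
  Q `<< P -> {ae P, forall w, density P Q w = m * z w} -> M1 Q.
Proof.
move=> pz m0 QP dE; split=> // g Kg.
have [c gc] := K_bounded_below T_ge0 Kg.
have mg := measurable_L0 g.
suff [ig le0] : intble Q g /\ \int[Q]_w g w <= 0.
  split=> //; rewrite unlock -[leLHS]fineK ?lee_fin//.
  exact: integrable_fin_num ig.
(* The truncations [min g n] of [g] in [K] belong to [C]. *)
apply: (intble_of_truncations mg (ae_null_dominates QP gc)) => n.
have mmin : measurable_fun setT (fun w =>
  Num.min (g w) n%:R) by exact: measurable_minr.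
have bmin : {ae P, forall w, `|Num.min (g w) n%:R| <= `|c| + n%:R}.
  apply: filterS gc => w gw; have n0 : (0 : R) <= n%:R by [].
  have := ler_norm c; have := normr_ge0 c => c0 c1.
  by rewrite ler_norml; case: (leP (g w) n%:R) => ?; apply/andP; split; lra.
have [iz le0] : intble P (fun w => Num.min (g w) n%:R * z w) /\
    \int[P]_w (Num.min (g w) n%:R * z w) <= 0.
  apply: (polar_C_Rintegral pz mmin Kg bmin).
  by apply: aeW => w; rewrite ge_min lexx.
have iQ : intble Q (fun w => Num.min (g w) n%:R).
  by apply: le_intble_ae (intble_cst Q (`|c| +
    n%:R)) (ae_null_dominates QP bmin).
rewrite -(Rintegral_density QP iQ).
have e : {ae P, forall w, Num.min (g w) n%:R * density P Q w =
    m * (Num.min (g w) n%:R * z w)}.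
  by apply: filterS dE => w ->; rewrite mulrCA.
rewrite (eq_Rintegral_ae (intble_densityM QP iQ) (intbleZ m iz) e)
  RintegralZl//.
by rewrite pmulr_rle0.
Qed.

Lemma polar_C_subset : polar P T F X Phi C `<=` co_MPhi.
Proof.
move=> z pz; have [[n [a [Q [MQ zE]]]] _] := pz.
have QP i := MPhi_dominates (MQ i).
have iz : intble P z.
  apply: intble_ae_eq (measurable_L0 z) _ (intble_density_sum a QP).
  by apply: filterS zE => w ->.
have z0 : {ae P, forall w, 0 <= z w}.
  apply: (ae_ge0_of_Rintegral iz) => A mA.
  have [g Kg g0] := K0 X F_usual T_ge0.
  have [|||iA leA] := @polar_C_Rintegral z (fun w => - \1_A w) 1 g pz _ Kg.
  - by apply: measurable_funN.
  - by apply: aeW => w; rewrite normrN indicE; case: (_ \in _);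
      rewrite ?normr1 ?normr0.
  - by apply: filterS g0 => w ->; rewrite oppr_le0 indicE ler0n.
  have izA := intble_Mindic mA iz.
  rewrite -oppr_le0 -mulN1r -(RintegralZl _ measurableT izA).
  apply: le_trans leA; rewrite le_eqVlt; apply/orP; left; apply/eqP.
  by apply: eq_Rintegral => w _; rewrite mulN1r mulNr mulrC.
have [m0|m_le0] := ltP 0 (\int[P]_w z w); last first.
  (* A nonnegative [z] whose integral is at most 0 vanishes a.s. and is the empty combination. *)
  exists 0%N, (fun=> 0), (fun i : 'I_0 => P); split; first by case.
  have eN : (\int[P]_w `|(z w)%:E| = 0)%E.
    rewrite -[LHS]fineK; last exact: integrable_fin_num (intble_norm iz).
    congr EFin; rewrite -[LHS]/(\int[P]_w `|z w|); apply/eqP.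
    rewrite eq_le Rintegral_ge0// andbT; apply: le_trans m_le0.
    apply: (le_Rintegral_ae (intble_norm iz) iz).
    by apply: filterS z0 => w h; rewrite ger0_norm.
  have := (ae_eq_integral_abs P measurableT (measurable_int _ iz)).1 eN.
  by apply: filterS => w /(_ I) /= [] ->; rewrite big_ord0.
set m := \int[P]_w z w in m0.
have mi0 : 0 < m^-1 by rewrite invr_gt0.
have iq : intble P (fun w => m^-1 * z w) by exact: intbleZ.
have q0 : {ae P, forall w, 0 <= m^-1 * z w}.
  by apply: filterS z0 => w h; rewrite mulr_ge0// ltW.
have q1 : \int[P]_w (m^-1 * z w) = 1 by rewrite RintegralZl// mulVf// gt_eqF.
have [Qz QzP dE] := probability_of_density iq q0 q1.
have M1z : M1 Qz by exact: (M1_of_polar_C pz mi0).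
have s0 : 0 <= \sum_(i < n) `|a i| by apply: sumr_ge0.
have MQz : MPhi Qz.
  (* Each [a i] is at most the sum of all [|a j|], which places [z] below a multiple of the plain
     sum of the densities. *)
  apply: (MPhi_of_dominated Phi_convex Phi_growth Phi0_finite
    (c := m^-1 * \sum_(i < n) `|a i|) _ M1z MQ);
      first by rewrite mulr_ge0// ltW.
  have y0 : {ae P, forall w i, 0 <= density P (Q i) w}.
    exact: (ae_forall_ord (fun i => density_ge0 (QP i))).
  apply: filterS3 dE zE y0 => w -> -> y0; rewrite -mulrA ler_wpM2l ?(ltW mi0)//.
  rewrite mulr_sumr; apply: ler_sum => i _; apply: ler_wpM2r => //.
  by apply: le_trans (ler_norm _) _; rewrite (bigD1 i)//= lerDl;
    apply: sumr_ge0.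
exists 1%N, (fun=> m), (fun=> Qz); split; first by move=> _; split=> //;
  exact: ltW.
by apply: filterS dE => w ->; rewrite big_ord1 mulrA mulfV ?mul1r// gt_eqF.
Qed.

End PolarOfC.

(** * Separation in L1 by a measure *)

Section IntegrableFunctionals.
Import HBSimple.
Context (R : realType) (disp : measure_display) (T : measurableType disp).

(** Integrable functions form the vector space [LfunType] at exponent 1. The functional is carried
    back to plain functions, with the junk value 0 at nonintegrable ones. *)
Lemma Hahn_Banach_intble (mu : {measure set T -> \bar R}) (p : (T -> R) -> R)
    (f : T -> R) :
  (forall u v, intble mu u -> intble mu v ->
     p (fun w => u w + v w) <= p u + p v) ->
  (forall t u, 0 < t -> intble mu u -> p (fun w => t * u w) <= t * p u) ->
  intble mu f ->
  exists phi : (T -> R) -> R,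
    [/\ forall u v, intble mu u -> intble mu v ->
          phi (fun w => u w + v w) = phi u + phi v,
        forall t u, intble mu u -> phi (fun w => t * u w) = t * phi u,
        forall u, intble mu u -> phi u <= p u & phi f = p f].
Proof.
move=> pD pZ intf; pose V := LfunType mu (lexx (1%E : \bar R)).
have iV (v : V) : intble mu v by apply/Lfun1_integrable; exact: LfunP.
pose q (v : V) := p v.
have sq : sublinear (V := V) q.
  apply: sublinearW => [u v|t u t0]; first by exact: (pD u v (iV u) (iV v)).
  exact: (pZ t u t0 (iV u)).
have sub u : intble mu u -> exists v : V, u = v :> (T -> R).
  by move=> /Lfun1_integrable iu; exists (Lfun_Sub (lexx 1%E) iu).
have [f' ff'] := sub f intf.
have [h [hq hf]] := Hahn_Banach_sublinear f' sq.
pose phi u := if pselect (exists v : V, u = v :> (T -> R)) is left e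
  then (h (projT1 (cid e)) : R) else 0.
have phiE (v : V) : phi v = h v.
  rewrite /phi; case: pselect => [e|]; last by case; exists v.
  by case: cid => v' /= vv'; congr (h _); apply/esym/val_inj.
exists phi; split.
- move=> u v /sub[u' ->] /sub[v' ->].
  by rewrite -[X in phi X]/((u' + v' : V) : T -> R) !phiE linearD.
- move=> t u /sub[u' ->].
  by rewrite -[X in phi X]/((t *: u' : V) : T -> R) !phiE linearZ.
- by move=> u /sub[u' ->]; rewrite phiE; exact: hq.
- by rewrite ff' phiE hf.
Qed.

(** * Functionals below a multiple of the integral of the positive part are integrals *)

Section Representation.
Variables (Q : probability T R) (phi : (T -> R) -> R) (c : R).
Hypothesis c0 : 0 <= c.
Hypothesis phiD : forall u v, intble Q u -> intble Q v ->
  phi (fun w => u w + v w) = phi u + phi v.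
Hypothesis phiZ : forall t u, intble Q u -> phi (fun w => t * u w) = t * phi u.
Hypothesis phi_le : forall u, intble Q u -> phi u <=
    c * \int[Q]_w Num.max (u w) 0.

Let phi0 : phi (fun=> 0) = 0.
Proof.
by have := phiZ 0 (intble_cst Q 0); rewrite !mul0r.
Qed.

Let phiN u : intble Q u -> phi (fun w => - u w) = - phi u.
Proof.
move=> iu; rewrite -mulN1r -phiZ//; congr phi.
by apply/funext => w; rewrite mulN1r.
Qed.

Let phiB u v : intble Q u -> intble Q v -> phi (fun w => u w - v w) =
    phi u - phi v.
Proof.
move=> iu iv; rewrite -phiN// -phiD//.
have := intbleZ (-1) iv; congr (intble Q _).
by apply/funext => w; rewrite mulN1r.
Qed.

(** At [- u] the bound [phi_le] is 0, because the positive part of [- u] vanishes. *)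
Let phi_ge0 u : intble Q u -> (forall w, 0 <= u w) -> 0 <= phi u.
Proof.
move=> iu u0; rewrite -oppr_le0 -phiN//.
have iNu : intble Q (fun w => - u w).
  have := intbleZ (-1) iu; congr (intble Q _).
  by apply/funext => w; rewrite mulN1r.
apply: (le_trans (phi_le iNu)).
have -> : \int[Q]_w Num.max (- u w) 0 = \int[Q]_w (0 : R).
  by apply: eq_Rintegral => w _; apply/max_idPr; rewrite oppr_le0.
by rewrite Rintegral_cst_probability mulr0.
Qed.

Let phi_le_pos u : intble Q u -> (forall w, 0 <= u w) -> phi u <=
    c * \int[Q]_w u w.
Proof.
move=> iu u0; apply: (le_trans (phi_le iu)).
suff -> : \int[Q]_w Num.max (u w) 0 = \int[Q]_w u w by [].
by apply: eq_Rintegral => w _; exact/max_idPl.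
Qed.

Let phi_norm u : intble Q u -> `|phi u| <= c * \int[Q]_w `|u w|.
Proof.
move=> iu; have inu := intble_norm iu.
have h v : intble Q v -> (forall w, `|v w| = `|u w|) -> phi v <=
  c * \int[Q]_w `|u w|.
  move=> iv vu; have h1 : 0 <= phi (fun w => `|u w| - v w).
    by apply: phi_ge0 => [|w]; [exact: intbleB|rewrite subr_ge0 -vu ler_norm].
  rewrite phiB// in h1; have := phi_le_pos inu (fun w => normr_ge0 _).
  by lra.
rewrite ler_norml h// andbT lerNl -phiN// h//; last by move=> w; rewrite normrN.
have := intbleZ (-1) iu; congr (intble Q _).
by apply/funext => w; rewrite mulN1r.
Qed.

Let phi_sum (I : Type) (s : seq I) (h : I -> T -> R) : (forall i,
    intble Q (h i)) ->
  phi (fun w => \sum_(i <- s) h i w) = \sum_(i <- s) phi (h i).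
Proof.
move=> ih; elim: s => [|i s IH].
  by rewrite big_nil -phi0; congr phi; apply/funext => w; rewrite big_nil.
rewrite big_cons -IH -phiD//; last exact: intble_sum.
by congr phi; apply/funext => w; rewrite big_cons.
Qed.

(* The value [0] on non-measurable sets is a junk value. *)
Definition functional_measure (A : set T) : \bar R :=
  if pselect (measurable A) then (phi \1_A)%:E else 0%E.

Let nuE A : measurable A -> functional_measure A = (phi \1_A)%:E.
Proof. by rewrite /functional_measure; case: pselect. Qed.

Let nu0 : functional_measure set0 = 0%E.
Proof. by rewrite nuE// indic0; congr EFin; exact: phi0. Qed.

Let nu_ge0 A : (0 <= functional_measure A)%E.
Proof.
rewrite /functional_measure; case: pselect => // mA; rewrite lee_fin.
by apply: phi_ge0 => [|w]; [exact: intble_indic|rewrite indicE ler0n].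
Qed.

Let sum_indic_le (A : nat -> set T) n w : trivIset setT A ->
  \sum_(0 <= i < n) (\1_(A i) w : R) <= \1_(\bigcup_i A i) w.
Proof.
move=> tA; have [[j _ Ajw]|nw] := pselect ((\bigcup_i A i) w); last first.
  rewrite big1 ?indicE ?ler0n// => i _.
  by rewrite indicE memNset// => Aiw; apply: nw; exists i.
have iE i : \1_(A i) w = (i == j)%:R :> R.
  rewrite indicE; have [->|ij] := eqVneq i j; first by rewrite mem_set.
  rewrite memNset// => Aiw; move/eqP: ij; apply; apply: tA => //.
  by exists w.
rewrite [leRHS]indicE mem_set; last by exists j.
under eq_bigr do rewrite iE.
rewrite -natr_sum ler_nat big_mkord; have [jn|nj] := ltnP j n.
  rewrite (bigD1 (Ordinal jn))//= eqxx big1// => i.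
  by rewrite -val_eqE/= => /negbTE ->.
by rewrite big1// => i _; rewrite ltn_eqF// (leq_trans (ltn_ord i)).
Qed.

(** Countable additivity is inherited from [Q]: the defect of [phi] on a partial union lies between
    0 and [c] times the defect of [Q], which tends to 0. *)
Let nu_sigma_additive : semi_sigma_additive functional_measure.
Proof.
move=> A mA tA mUA; set U := \bigcup_i A i.
have iU : intble Q \1_U by exact: intble_indic.
have iA i : intble Q \1_(A i) by exact: intble_indic.
have -> : (fun n => \sum_(0 <= i < n) functional_measure (A i))%E =
    EFin \o (fun n => \sum_(0 <= i < n) phi \1_(A i)).
  apply/funext => n /=; rewrite -sumEFin; apply: eq_bigr => i _.
  by rewrite nuE.
rewrite nuE//; apply: cvg_EFin; first by apply: nearW.
have cvgQ : \sum_(0 <= i < n) fine (Q (A i)) @[n --> \oo] --> fine (Q U).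
  have h : (\sum_(0 <= i < n) Q (A i))%E @[n --> \oo] --> (fine (Q U))%:E.
    rewrite fineK ?fin_num_measure//.
    exact: (measure_semi_sigma_additive (s := Q)).
  have /fine_cvg := h; apply: cvg_trans; apply: near_eq_cvg; apply: nearW => n.
  by rewrite -[X in X = _]sum_fine// => i _; exact: fin_num_measure.
have bound n : phi \1_U - c * (fine (Q U) - \sum_(0 <= i < n) fine (Q (A i))) <=
    \sum_(0 <= i < n) phi \1_(A i) <= phi \1_U.
  have iS : intble Q (fun w => \sum_(0 <=
    i < n) \1_(A i) w) by exact: intble_sum.
  have iD := intbleB iU iS.
  have D0 w : 0 <= \1_U w - \sum_(0 <= i < n) \1_(A i) w :> R.
    by rewrite subr_ge0; exact: sum_indic_le.
  have h1 := phi_ge0 iD D0; have h2 := phi_le_pos iD D0.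
  rewrite phiB// phi_sum// in h1; rewrite phiB// phi_sum// in h2.
  have e : \sum_(0 <= i < n) \int[Q]_w \1_(A i) w = \sum_(0 <=
    i < n) fine (Q (A i)).
    by apply: eq_bigr => i _; rewrite Rintegral_indic.
  rewrite RintegralB// Rintegral_sum// e Rintegral_indic// in h2.
  by apply/andP; split; lra.
have lo : phi \1_U - c * (fine (Q U) - \sum_(0 <= i < n) fine (Q (A i)))
    @[n --> \oo] --> phi \1_U.
  rewrite -[X in _ --> X](_ : phi \1_U - c * (fine (Q U) - fine (Q U)) = _).
    apply: cvgB; first exact: cvg_cst.
    by apply: cvgMr; apply: cvgB => //; exact: cvg_cst.
  by rewrite subrr mulr0 subr0.
by apply: (squeeze_cvgr _ lo (cvg_cst _)); exact: nearW.
Qed.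

HB.instance Definition _ := isMeasure.Build _ _ _ functional_measure
  nu0 nu_ge0 nu_sigma_additive.

Local Notation nu := (functional_measure : {measure set T -> \bar R}).

Lemma functional_measure_le A : measurable A ->
  (functional_measure A <= c%:E * Q A)%E.
Proof.
move=> mA; rewrite nuE// -[Q A]fineK ?fin_num_measure// -EFinM lee_fin.
have := phi_le_pos (intble_indic Q mA) (fun w => _).
by rewrite Rintegral_indic//; apply => w; rewrite indicE ler0n.
Qed.

Lemma functional_measure_intble u : intble Q u ->
  intble (functional_measure : {measure set T -> \bar R}) u /\
  \int[(functional_measure : {measure set T -> \bar R})]_w `|u w| <=
    c * \int[Q]_w `|u w|.
Proof.
move=> iu; have mu_ := intble_measurable iu; pose c' := NngNum c0.
have mn : measurable_fun setT (fun w => `|u w|%:E).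
  by apply/measurable_EFinP; exact: measurableT_comp.
have h : (\int[(functional_measure : {measure set T -> \bar R})]_w `|u w|%:E <=
    c%:E * \int[Q]_w `|u w|%:E)%E.
  have n0 w : [set: T] w -> (0 <= `|u w|%:E)%E by rewrite lee_fin.
  rewrite -[c]/(c'%:num) -(ge0_integral_mscale Q measurableT c' mn n0).
  by apply: ge0_le_measure_integral => // S mS; exact: functional_measure_le.
have fQ := integrable_fin_num measurableT (intble_norm iu).
have nfin : (\int[(functional_measure : {measure set T ->
  \bar R})]_w `|u w|%:E < +oo)%E.
  by apply: (le_lt_trans h); rewrite -[X in (_ * X)%E]fineK// -EFinM ltry.
split; first by apply/integrableP; split => //; exact/measurable_EFinP.
rewrite -lee_fin EFinM /Rintegral !fineK//.
by rewrite ge0_fin_numE//; apply: integral_ge0 => w _; rewrite lee_fin.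
Qed.

(** Both sides agree on simple functions by linearity and are Lipschitz with constant [c] for the
    L1(Q)-norm, whence the factor [2 * c] in the approximation error. *)
Lemma functional_measure_integral u : intble Q u ->
  \int[(functional_measure : {measure set T -> \bar R})]_w u w = phi u.
Proof.
set nu := (functional_measure : {measure set T -> \bar R}) => iu.
have [inu _] := functional_measure_intble iu.
have simple (g : {sfun T >-> R}) : intble Q g -> \int[nu]_w g w = phi g.
  move=> ig; pose r : seq R := finmap.enum_fset (fset_set (range g)).
  have gE : (g : T -> R) = fun w => \sum_(y <- r) y * \1_(g @^-1` [set y]) w.
    by apply/funext => w; rewrite {1}(fimfunE g) fsbig_finite.
  have iQ y : intble Q (fun w => y * \1_(g @^-1` [set y]) w).
    by apply: intbleZ; exact: intble_indic.
  have inu' y : intble nu \1_(g @^-1` [set y]).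
    by have [] := functional_measure_intble (intble_indic Q (measurable_sfunP g
      (measurable_set1 y))).
  rewrite gE Rintegral_sum; last by move=> y; exact: intbleZ.
  rewrite phi_sum//; apply: eq_bigr => y _.
  have mP : measurable (g @^-1` [set y]) by [].
  have ei := RintegralZl y measurableT (inu' y).
  rewrite (Rintegral_indic nu mP) in ei.
  rewrite [LHS]ei [RHS](phiZ y (intble_indic Q mP)); congr (_ * _).
  exact: (congr1 fine (nuE mP)).
have [g [ig _ gu]] := approximation_sfun_integrable measurableT iu.
have bound n : `|\int[nu]_w u w - phi u| <= 2 * c * \int[Q]_w `|u w - g n w|.
  have iQg : intble Q (g n) := ig n.
  have [inug _] := functional_measure_intble iQg.
  have iD := intbleB iu iQg; have [inD leD] := functional_measure_intble iD.
  have -> : \int[nu]_w u w - phi u =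
      \int[nu]_w (u w - g n w) - phi (fun w => u w - g n w).
    by rewrite RintegralB// phiB// simple//; lra.
  apply: (le_trans (ler_normB _ _)).
  have := phi_norm iD; have := le_normr_Rintegral measurableT inD; lra.
apply/eqP; rewrite -subr_eq0 -normr_le0.
have lim0 : 2 * c * \int[Q]_w `|u w - g n w| @[n --> \oo] --> 2 * c * 0.
  apply: cvgMr; apply: (fine_cvg (f := fun n => \int[Q]_w `|u w - g n w|%:E)%E).
  exact: gu.
rewrite mulr0 in lim0.
apply: (ler_cvg_to (cvg_cst _) lim0); exact: nearW.
Qed.

Lemma measure_of_functional : exists nu : {measure set T -> \bar R},
  [/\ forall A, measurable A -> nu A = (phi \1_A)%:E,
      forall A, measurable A -> (nu A <= c%:E * Q A)%E,
      forall u, intble Q u -> intble nu u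
    & forall u, intble Q u -> \int[nu]_w u w = phi u].
Proof.
exists (functional_measure : {measure set T -> \bar R}); split.
- exact: nuE.
- exact: functional_measure_le.
- by move=> u iu; have [] := functional_measure_intble iu.
- exact: functional_measure_integral.
Qed.

End Representation.
End IntegrableFunctionals.

(** * Separation from a convex cone in L1(Q) *)

Section L1Separation.
Context (R : realType) (disp : measure_display) (T : measurableType disp).
Variables (Q : probability T R) (A : set (T -> R)).
Hypothesis A_intble : forall a, A a -> intble Q a.
Hypothesis A0 : A (fun=> 0).
Hypothesis AD : forall a b, A a -> A b -> A (fun w => a w + b w).
Hypothesis AZ : forall t a, 0 < t -> A a -> A (fun w => t * a w).

Let excess (u a : T -> R) := \int[Q]_w Num.max (u w - a w) 0.
(* The distance from [u] to [A - L1_+(Q)] in L1(Q). As a sublinear functional it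
   is dominated by the integral of [u^+], so that the linear functionals below
   it are integrals with respect to measures with a bounded density. *)
Definition excess_inf (u : T -> R) := inf [set z | exists2 a, A a & z =
    excess u a].

Let excess_ge0 u a : 0 <= excess u a.
Proof. by apply: Rintegral_ge0 => w _; rewrite le_max lexx orbT. Qed.

Let has_inf_excess u : has_inf [set z | exists2 a, A a & z = excess u a].
Proof.
split; first by exists (excess u (fun=> 0)), (fun=> 0).
by exists 0 => _ [a _ ->]; exact: excess_ge0.
Qed.

Let excess_inf_le u a : A a -> excess_inf u <= excess u a.
Proof. by move=> Aa; apply: ge_inf; [exact: (has_inf_excess u).2|exists a]. Qed.

Let intble_excess u a : intble Q u -> A a -> intble Q (fun w =>
    Num.max (u w - a w) 0).
Proof. by move=> iu Aa; apply: intble_max0; apply: intbleB => //;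
  exact: A_intble. Qed.

Lemma excess_infD u v : intble Q u -> intble Q v ->
  excess_inf (fun w => u w + v w) <= excess_inf u + excess_inf v.
Proof.
move=> iu iv; apply/ler_addgt0Pr => e e0.
have e20 : 0 < e / 2 by rewrite divr_gt0.
have [_ [a Aa ->] ha] := inf_adherent e20 (has_inf_excess u).
have [_ [b Ab ->] hb] := inf_adherent e20 (has_inf_excess v).
rewrite -/(excess_inf u) in ha; rewrite -/(excess_inf v) in hb.
apply: (le_trans (excess_inf_le _ (AD Aa Ab))).
have le1 : excess (fun w => u w + v w) (fun w => a w + b w) <= excess u a +
  excess v b.
  rewrite /excess -RintegralD//; [|exact: intble_excess..].
  apply: le_Rintegral_ae.
  - by apply: intble_excess; [exact: intbleD|exact: AD].
  - by apply: intbleD; exact: intble_excess.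
  - apply: aeW => w; have m1 (r : R) : r <= Num.max r 0 by rewrite le_max lexx.
    have m0 (r : R) : 0 <= Num.max r 0 by rewrite le_max lexx orbT.
    have := m1 (u w - a w); have := m1 (v w - b w).
    have := m0 (u w - a w); have := m0 (v w - b w).
    by rewrite ge_max => *; apply/andP; split; lra.
lra.
Qed.

Lemma excess_infZ t u : 0 < t -> intble Q u ->
  excess_inf (fun w => t * u w) <= t * excess_inf u.
Proof.
move=> t0 iu; rewrite -ler_pdivrMl//; apply: lb_le_inf;
  first exact: (has_inf_excess u).1.
move=> _ [a Aa ->]; rewrite ler_pdivrMl//.
apply: (le_trans (excess_inf_le _ (AZ t0 Aa))).
rewrite /excess -RintegralZl//; last exact: intble_excess.
rewrite le_eqVlt; apply/orP; left; apply/eqP; apply: eq_Rintegral => w _.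
by rewrite -mulrBr maxr_pMr ?mulr0// ltW.
Qed.

(** The functional equals [excess_inf f >= e] at [f], and is nonpositive on [A] since each [a] has
    excess 0 over itself. Dividing by its value at 1 turns the measure into a probability. *)
Theorem L1_separation f (e : R) : intble Q f -> 0 < e ->
  (forall a, A a -> e <= \int[Q]_w Num.max (f w - a w) 0) ->
  exists (Q1 : probability T R) (c : R), [/\ 0 <= c,
    forall B, measurable B -> (Q1 B <= c%:E * Q B)%E,
    forall u, intble Q u -> intble Q1 u,
    forall a, A a -> \int[Q1]_w a w <= 0 &
    0 < \int[Q1]_w f w].
Proof.
move=> intf e0 ef.
have [phi [phiD phiZ phi_le phif]] :=
  Hahn_Banach_intble excess_infD excess_infZ intf.
have phif0 : 0 < phi f.
  rewrite phif; apply: (lt_le_trans e0); apply: lb_le_inf.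
    exact: (has_inf_excess f).1.
  by move=> _ [a Aa ->]; exact: ef.
have phiA a : A a -> phi a <= 0.
  move=> Aa; apply: (le_trans (phi_le _ (A_intble Aa))).
  apply: (le_trans (excess_inf_le _ Aa)).
  have -> : excess a a = \int[Q]_w (0 : R).
    by apply: eq_Rintegral => w _; rewrite subrr maxxx.
  by rewrite Rintegral_cst_probability.
have phi_le1 u : intble Q u -> phi u <= 1 * \int[Q]_w Num.max (u w) 0.
  move=> iu; rewrite mul1r; apply: (le_trans (phi_le u iu)).
  apply: (le_trans (excess_inf_le _ A0)).
  by rewrite le_eqVlt; apply/orP; left; apply/eqP; apply: eq_Rintegral => w _;
    rewrite subr0.
have ic1 : intble Q (\1_setT : T -> R) by exact: intble_indic.
(* A measure of mass 0 would give [phi f = 0]. The representation is used here for this alone, and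
   again after normalization. *)
have m0 : 0 < phi \1_setT.
  have [nu [nuE _ nui nuI]] := measure_of_functional ler01 phiD phiZ phi_le1.
  have nuT := nuE _ measurableT.
  rewrite lt_neqAle eq_sym; apply/andP; split; last by rewrite -lee_fin -nuT.
  apply/eqP => phi10; move: phif0; rewrite -(nuI f intf) /Rintegral.
  rewrite null_set_integral ?ltxx//; last by rewrite nuT phi10.
  exact: measurable_int (nui f intf).
set m := phi \1_setT in m0.
have mi0 : 0 < m^-1 by rewrite invr_gt0.
pose psi u := m^-1 * phi u.
have psiD u v : intble Q u -> intble Q v ->
    psi (fun w => u w + v w) = psi u + psi v.
  by move=> iu iv; rewrite /psi phiD// mulrDr.
have psiZ t u : intble Q u -> psi (fun w => t * u w) = t * psi u.
  by move=> iu; rewrite /psi phiZ// mulrCA.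
have psi_le u : intble Q u -> psi u <= m^-1 * \int[Q]_w Num.max (u w) 0.
  by move=> iu; rewrite ler_pM2l//; have := phi_le1 u iu; rewrite mul1r.
have [nu [nuE nuQ nui nuI]] := measure_of_functional (ltW mi0) psiD psiZ psi_le.
have nuT : nu setT = 1%E by rewrite nuE// /psi mulVf// gt_eqF.
have [Q1 Q1E] := probability_of_measure Q nuT.
have Q1I u : (\int[Q1]_w u w = \int[nu]_w u w)%E.
  by apply: eq_measure_integral => B _ _; exact: Q1E.
exists Q1, m^-1; split.
- exact: ltW.
- by move=> B mB; rewrite Q1E; exact: nuQ.
- move=> u iu; have /integrableP[mu_ fu] := nui u iu.
  by apply/integrableP; split => //; rewrite Q1I.
- move=> a Aa; rewrite /Rintegral Q1I -[fine _]/(\int[nu]_w a w) nuI;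
    last exact: A_intble.
  by rewrite /psi pmulr_rle0// phiA.
- by rewrite /Rintegral Q1I -[fine _]/(\int[nu]_w f w) nuI// /psi mulr_gt0.
Qed.

End L1Separation.

(** * The polar of co(M_Phi) lies in C_Phi *)

Section CopolarInCPhi.
Context (R : realType) (disp : measure_display) (Omega : measurableType disp).
Variables (P : probability Omega R) (T : R) (F : R -> set (set Omega)).
Variables (d : nat) (X : 'I_d -> R -> Omega -> R) (Phi : R -> R).
Local Notation K := (K P T F X).
Local Notation MPhi := (MPhi P T F X Phi).
Local Notation M1 := (M1 P T F X).
Local Notation co_MPhi := (co_MPhi P T F X Phi).

Hypothesis F_usual : usual_filtration P T F.
Hypothesis T_ge0 : 0 <= T.
Hypothesis X_semimartingale : semimartingale P T F X.
Hypothesis Phi_convex : convex_function (E := R^o) `]0, +oo[%classic Phi.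
Hypothesis Phi_growth : growth_condition Phi.
Hypothesis Phi0_finite : (Phi_at0 Phi < +oo)%E.

Lemma copolar_subset_CPhi : copolar P T F X Phi co_MPhi `<=` CPhi P T F X Phi.
Proof.
move=> f /copolar_co_MPhi[Lf fle0]; split=> // Q MQ.
have QP := MPhi_dominates MQ; have M1Q : M1 Q by case: MQ.
have intf := L_intble Lf MQ; split=> // e e0.
apply: contrapT => nclose.
(* Representatives of classes add up only almost surely; saturating under [Q]-a.s. equality makes
   [A] a cone of functions. *)
pose A : set (Omega -> R) :=
  [set u | intble Q u /\ exists2 g, K g & {ae Q, forall w, u w = g w}].
have [Q1 [c [c0 Q1Q Q1i Q1A Q1f]]] : exists (Q1 : probability Omega R) (c : R),
    [/\ 0 <= c, forall B, measurable B -> (Q1 B <= c%:E * Q B)%E,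
    forall u, intble Q u -> intble Q1 u,
    forall a, A a -> \int[Q1]_w a w <= 0 & 0 < \int[Q1]_w f w].
  apply: (@L1_separation _ _ _ Q A _ _ _ _ f e) => //.
  - by move=> a [].
  - split; first exact: intble_cst.
    have [g Kg g0] := K0 X F_usual T_ge0; exists g => //.
    by apply: filterS (ae_null_dominates QP g0) => w ->.
  - move=> a b [ia [g1 Kg1 e1]] [ib [g2 Kg2 e2]]; split; first exact: intbleD.
    have [g Kg ge] := KD F_usual T_ge0 X_semimartingale Kg1 Kg2; exists g => //.
    by apply: filterS3 (ae_null_dominates QP ge) e1 e2 => w -> -> ->.
  - move=> t a t0 [ia [g1 Kg1 e1]]; split; first exact: intbleZ.
    have [g Kg ge] := KZ F_usual T_ge0 X_semimartingale (ltW t0) Kg1;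
      exists g => //.
    by apply: filterS2 (ae_null_dominates QP ge) e1 => w -> ->.
  - move=> a [ia [g Kg ag]]; rewrite leNgt; apply/negP => lte; apply: nclose.
    have ig := K_intble Kg M1Q.
    have ik : intble Q (fun w => Num.max (g w - f w) 0).
      by apply: intble_max0; exact: intbleB.
    (* This is [min(f, g)], whose distance to [f] is exactly the integral of [(f - g)^+]. *)
    exists (fun w => g w - Num.max (g w - f w) 0).
      exists g, (fun w => Num.max (g w - f w) 0); split=> //; split=> //.
      by apply: aeW => w; rewrite le_max lexx orbT.
    have im : intble Q (fun w => Num.max (f w - g w) 0).
      by apply: intble_max0; exact: intbleB.
    have ima : intble Q (fun w => Num.max (f w - a w) 0).
      by apply: intble_max0; exact: intbleB.
    have eq1 : {ae Q, forall w, Num.max (f w - a w) 0 = Num.max (f w - g w) 0}.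
      by apply: filterS ag => w ->.
    rewrite (eq_Rintegral_ae ima im eq1) in lte.
    rewrite Lnorm1 (_ : (fun w => _) = fun w => (Num.max (f w - g w) 0)%:E).
      by rewrite -[X in (X < _)%E]fineK ?lte_fin//;
        exact: integrable_fin_num im.
    apply/funext => w /=; congr EFin.
    have [gf|fg] := leP (g w - f w) 0.
      have h : 0 <= f w - g w by lra.
      by rewrite subr0 ger0_norm//; apply/esym/max_idPl.
    have -> : f w - (g w - (g w - f w)) = 0 by lra.
    have h : f w - g w <= 0 by lra.
    by rewrite normr0; apply/esym/max_idPr.
have Q1_Q : Q1 `<< Q.
  apply/null_content_dominatesP => B mB QB; apply/eqP.
  by rewrite eq_le measure_ge0 andbT; have := Q1Q B mB; rewrite QB mule0.
have Q1P := null_dominates_trans Q1_Q QP.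
have M1Q1 : M1 Q1.
  split=> // g Kg; have ig := K_intble Kg M1Q; have ig1 := Q1i _ ig.
  split=> //; rewrite unlock -[leLHS]fineK ?lee_fin;
    last exact: integrable_fin_num ig1.
  by apply: Q1A; split=> //; exists g => //; exact: aeW.
have MQ1 : MPhi Q1.
  apply: (MPhi_of_dominated Phi_convex Phi_growth Phi0_finite c0
    (Qs := fun _ : 'I_1 => Q)) => //.
  have : {ae P, forall w, density P Q1 w <= c * density P Q w}.
    apply: density_le_of_measure_le => // B mB.
    rewrite -lee_fin EFinM !fineK ?fin_num_measure//; exact: Q1Q.
  by apply: filterS => w; rewrite big_ord1.
by have := fle0 Q1 MQ1; rewrite leNgt Q1f.
Qed.

End CopolarInCPhi.

(** * The duality *)

Section Closure.
Context (R : realType) (disp : measure_display) (Omega : measurableType disp).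
Variables (P : probability Omega R) (T : R) (F : R -> set (set Omega)).
Variables (d : nat) (X : 'I_d -> R -> Omega -> R) (Phi : R -> R).
Local Notation L0 := 'L0[R](P).
Local Notation C := (C P T F X).
Local Notation L := (L P T F X Phi).
Local Notation MPhi := (MPhi P T F X Phi).
Local Notation co_MPhi := (co_MPhi P T F X Phi).

Hypothesis F_usual : usual_filtration P T F.
Hypothesis T_ge0 : 0 <= T.
Hypothesis X_semimartingale : semimartingale P T F X.

Variables (V : tvsType R) (iota : V -> L0).
Hypothesis iota_bij : linear_bijection_onto_L P T F X Phi iota.
Hypothesis tau_compatible : compatible P T F X Phi iota.

Let iota_L v : L (iota v).
Proof. by have [_ <- _] := iota_bij; exists v. Qed.

Let iota_of f : L f -> exists v, iota v = f.
Proof. by have [_ <- _] := iota_bij; case=> v _ <-; exists v. Qed.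

Let iota_C_cone : is_cone (iota @^-1` C).
Proof.
have [iota_inj _ iota_lin] := iota_bij.
have iota0 : {ae P, forall w, iota 0 w = 0}.
  have := iota_lin 1 0 0; rewrite scale1r addr0.
  by apply: filterS => w; lra.
split.
- have [f Cf f0] := C0 X F_usual T_ge0; rewrite /preimage/=.
  suff -> : iota 0 = f by [].
  by apply: L0_eq; apply: filterS2 iota0 f0 => w -> ->.
- move=> u v Cu Cv; rewrite /preimage/=.
  have [f Cf fE] := CD F_usual T_ge0 X_semimartingale Cu Cv.
  suff -> : iota (u + v) = f by [].
  apply: L0_eq; have := iota_lin 1 u v; rewrite scale1r => h.
  by apply: filterS2 h fE => w -> ->; rewrite mul1r.
- move=> t u t0 Cu; rewrite /preimage/=.
  have [f Cf fE] := CZ F_usual T_ge0 X_semimartingale (ltW t0) Cu.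
  suff -> : iota (t *: u) = f by [].
  apply: L0_eq; have := iota_lin t u 0; rewrite addr0 => h.
  by apply: filterS3 h fE iota0 => w -> -> ->; rewrite addr0.
Qed.

(** One direction of compatibility: the expectation under [Q] is the pairing with its density, an
    element of [L'], hence it is tau-continuous. *)
Lemma MPhi_functional Q : MPhi Q -> exists phi : {linear V -> R^o},
  continuous phi /\ forall v, phi v = \int[Q]_w iota v w.
Proof.
move=> MQ; have QP := MPhi_dominates MQ; have [_ _ iota_lin] := iota_bij.
have iQ v : intble Q (iota v) by exact: L_intble.
pose phi0 v : R^o := \int[Q]_w iota v w.
have lphi : linear phi0.
  move=> a u v; rewrite /phi0.
  have iau := intbleZ a (iQ u).
  rewrite (eq_Rintegral_ae (iQ _) (intbleD iau (iQ v))
    (ae_null_dominates QP (iota_lin a u v))).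
  by rewrite (RintegralD measurableT iau (iQ v)) (RintegralZl a measurableT (iQ
    u)).
pose B := GRing.isLinear.Build R V R^o _ phi0 lphi.
pose phi : {linear V -> R^o} := HB.pack phi0 B.
exists phi; split=> //; apply/tau_compatible.
have [z ze] := L0_of P (intble_measurable (intble_density QP)).
have zs : {ae P, forall w, z w = \sum_(i < 1) 1 * density P Q w}.
  by apply: filterS ze => w ->; rewrite big_ord1 mul1r.
exists z; first by exists 1%N, (fun=> 1), (fun=> Q).
move=> v.
have [_ ->] := @pairing_sum _ _ _ _ _ _ _ _ _ _ z 1%N (fun=> 1) (fun=> Q)
  (iota_L v) (fun=> MQ) zs.
by rewrite big_ord1 mul1r.
Qed.

(** If [E_Q] were positive at a point of the closure, it would be positive on a neighbourhood, which
    meets [C]. *)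
Lemma closure_C_subset_copolar :
  iota @` closure (iota @^-1` C) `<=` copolar P T F X Phi co_MPhi.
Proof.
move=> _ [v clv <-]; apply/copolar_co_MPhi; split=> // Q MQ.
have [phi [cphi phiE]] := MPhi_functional MQ.
rewrite -phiE leNgt; apply/negP => phiv0.
have nv : nbhs v [set u | 0 < phi u] by apply: (cvgr_gt _ (cphi v)).
have [u [Cu /= phiu0]] := clv _ nv.
have : copolar P T F X Phi co_MPhi (iota u) by exact: C_subset_copolar.
move=> /copolar_co_MPhi[_ /(_ Q MQ)].
by rewrite -phiE leNgt phiu0.
Qed.

(** The other direction of compatibility: a continuous functional separating [f] from [C] is the
    pairing with some [z] in [L']. This [z] is in the polar of [C], hence in [co_MPhi], and cannot
    be positive at [f]. *)
Lemma copolar_subset_closure_C :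
  polar P T F X Phi C `<=` co_MPhi ->
  copolar P T F X Phi co_MPhi `<=` iota @` closure (iota @^-1` C).
Proof.
move=> polC f cof; have [v vf] := iota_of cof.1.
exists v => //; apply: contrapT => nclv.
have [phi [cphi phiC phiv]] := tvs_cone_separation iota_C_cone nclv.
have /tau_compatible[z L'z phiz] := cphi.
have pz : polar P T F X Phi C z.
  split=> // g Cg; have [u ug] := iota_of (C_subset_L Cg).
  by rewrite -ug -phiz lee_fin; apply: phiC; rewrite /preimage/= ug.
have := cof.2 z (polC z pz); rewrite -vf -phiz lee_fin.
by rewrite leNgt phiv.
Qed.

End Closure.

Theorem theorem17 (R : realType) (disp : measure_display)
    (Omega : measurableType disp) (P : probability Omega R)
    (T : R) (F : R -> set (set Omega))
    (d : nat) (X : 'I_d -> R -> Omega -> R) (Phi : R -> R)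
    (T_ge0 : 0 <= T)
    (F_usual : usual_filtration P T F)
    (X_semimartingale : semimartingale P T F X)
    (Phi_convex : convex_function (E := R^o) `]0, +oo[%classic Phi)
    (Phi_growth : growth_condition Phi)
    (Phi0_finite : (Phi_at0 Phi < +oo)%E)
    (MPhi_equivalent : exists2 Q : probability Omega R,
       MPhi P T F X Phi Q & P `<< Q)
    (V : tvsType R) (iota : V -> 'L0[R](P))
    (iota_bij : linear_bijection_onto_L P T F X Phi iota)
    (tau_compatible : compatible P T F X Phi iota) :
  iota @` closure (iota @^-1` C P T F X) = CPhi P T F X Phi
  /\ (polar P T F X Phi (CPhi P T F X Phi) = co_MPhi P T F X Phi
      /\ copolar P T F X Phi (co_MPhi P T F X Phi) = CPhi P T F X Phi).
Proof.
have polC : polar P T F X Phi (C P T F X) `<=` co_MPhi P T F X Phi.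
  exact: polar_C_subset.
have CPhiE : copolar P T F X Phi (co_MPhi P T F X Phi) = CPhi P T F X Phi.
  apply/seteqP; split; first exact: copolar_subset_CPhi.
  exact: CPhi_subset_copolar.
split; [|split=> //].
- rewrite -CPhiE; apply/seteqP; split.
    exact: closure_C_subset_copolar.
  exact: copolar_subset_closure_C.
(* Polars reverse inclusions: as [C] lies in [CPhi], the polar of [CPhi] lies in that of [C]. *)
- rewrite -CPhiE; apply/seteqP; split=> z.
    move=> [L'z h]; apply: polC; split=> // f Cf; apply: h.
    exact: C_subset_copolar.
  move=> coz; split; last by move=> f [_ h]; exact: h.
  by have [n [a [Q [aQ zE]]]] := coz; exists n, a, Q; split=> // i;
    have [] := aQ i.
Qed.
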